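(* Let $n$ be a positive integer, let $p>1$, $q=p/(p-1)$, and let $f$ and $g$ be nonnegative measurable functions on $\mathbb{R}^n$ such that $f\in L^p(\mathbb{R}^n)$ and $g\in L^q(\mathbb{R}^n)$. Put $$K_{n,p}=\frac{n\pi}{\sin (\pi/p)}\cdot\frac{\pi^{n/2}}{\Gamma(\frac{n}{2}+1)}.$$ Then the following inequality holds: $$\text{(a)}\quad \int_{\mathbb{R}^n}\int_{\mathbb{R}^n} \frac{f(x)g(y)}{|x|+|y|}\,|x|^{(1-n)\frac{1}{q}}\,|y|^{(1-n)\frac{1}{p}}\,\mathrm{d}x\,\mathrm{d}y \leq K_{n,p}\left(\int_{\mathbb{R}^n} f^p(x)\,\mathrm{d}x\right)^{1/p}\left(\int_{\mathbb{R}^n} g^q(y)\,\mathrm{d}y\right)^{1/q}.$$ Moreover, the following two inequalities hold and are equivalent to (a): $$\text{(b)}\quad \left(\int_{\mathbb{R}^n}\left(\int_{\mathbb{R}^n} \frac{f(x)}{|x|+|y|}\,|x|^{(1-n)\frac{1}{q}}\,\mathrm{d}x\right)^p |y|^{1-n}\,\mathrm{d}y\right)^{1/p}\leq K_{n,p}\left(\int_{\mathbb{R}^n} f^p(x)\,\mathrm{d}x\right)^{1/p},$$ $$\text{(c)}\quad \left(\int_{\mathbb{R}^n}\left(\int_{\mathbb{R}^n} \frac{g(y)}{|x|+|y|}\,|y|^{(1-n)\frac{1}{p}}\,\mathrm{d}y\right)^q |x|^{1-n}\,\mathrm{d}x\right)^{1/q}\leq K_{n,p}\left(\int_{\mathbb{R}^n}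 g^q(y)\,\mathrm{d}y\right)^{1/q}.$$ The constant $K_{n,p}$ is sharp in all three inequalities (a), (b), (c).
   Context: $|\cdot|$ is the Euclidean norm on $\mathbb{R}^n$ and $\Gamma$ is the usual Gamma function. A constant is sharp in an inequality if it cannot be replaced by a smaller constant valid for all admissible functions. *)

(* Defs.v *)
From HB Require Import structures.
From mathcomp Require Import all_boot all_order all_algebra.
From mathcomp Require Import all_classical all_reals all_analysis.

Set Implicit Arguments.
Unset Strict Implicit.
Unset Printing Implicit Defensive.
Import Order.TTheory GRing.Theory Num.Theory.
Import numFieldNormedType.Exports.

Local Open Scope classical_set_scope.
Local Open Scope ring_scope.

Section tuple_measure.
Context d (T : measurableType d) (R : realType).
Variable mu : {sigma_finite_measure set T -> \bar R}.

Definition cons_pair n (x : T * n.-tuple T) : n.+1.-tuple T :=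
  [the n.+1.-tuple T of x.1 :: x.2].

Lemma measurable_cons_pair n : measurable_fun setT (@cons_pair n).
Proof. exact: measurable_cons. Qed.

Section cons_measure.
Variables (n : nat) (nu : {sigma_finite_measure set (n.-tuple T) -> \bar R}).

Definition cons_measure : set (n.+1.-tuple T) -> \bar R :=
  pushforward (mu \x nu)%E (@cons_pair n).

Let cons_measure0 : cons_measure set0 = 0%E.
Proof. by rewrite /cons_measure /pushforward preimage_set0 measure0. Qed.

Let cons_measure_ge0 A : (0 <= cons_measure A)%E.
Proof. by rewrite /cons_measure /pushforward measure_ge0. Qed.

Let cons_measure_sigma_additive : semi_sigma_additive cons_measure.
Proof.
move=> F mF tF mUF; rewrite /cons_measure /pushforward preimage_bigcup.
apply: measure_semi_sigma_additive.
- by move=> i; rewrite -[X in measurable X]setTI; exact: measurable_cons_pair.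
- apply/trivIsetP => /= i j _ _ ij; rewrite -preimage_setI.
  by move/trivIsetP : tF => -> //; rewrite preimage_set0.
- rewrite -preimage_bigcup -[X in measurable X]setTI.
  exact: measurable_cons_pair.
Qed.

HB.instance Definition _ := isMeasure.Build _ _ _ cons_measure
  cons_measure0 cons_measure_ge0 cons_measure_sigma_additive.

Let cons_measure_sigma_finite : sigma_finite setT cons_measure.
Proof.
have /sigma_finiteP[F [TF ndF Foo]] := sigma_finiteT mu.
have /sigma_finiteP[G [TG ndG Goo]] := sigma_finiteT nu.
pose split_tuple (t : n.+1.-tuple T) : T * n.-tuple T :=
  (thead t, [tuple of behead t]).
have msplit : measurable_fun setT split_tuple.
  apply: measurable_fun_pair; first exact: measurable_tnth.
  exact: measurable_behead.
have splitK x : split_tuple (cons_pair x) = x.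
  by case: x => a t; congr pair; exact: val_inj.
exists (fun k => split_tuple @^-1` (F k `*` G k)).
  rewrite -preimage_bigcup; apply/esym/seteqP; split => // t _ /=.
  have : [set: T] (split_tuple t).1 by [].
  have : [set: n.-tuple T] (split_tuple t).2 by [].
  rewrite TF TG => -[k _ Gk] [l _ Fl]; exists (maxn k l) => //; split.
    by move: Fl; exact/subsetPset/ndF/leq_maxr.
  by move: Gk; exact/subsetPset/ndG/leq_maxl.
move=> k; have [mFk Fkoo] := Foo k; have [mGk Gkoo] := Goo k; split.
  rewrite -[X in measurable X]setTI; apply: msplit => //.
  exact: measurableX.
rewrite /cons_measure /pushforward (_ : _ @^-1` _ = F k `*` G k).
  by rewrite product_measure1E// lte_mul_pinfty// ge0_fin_numE.
by rewrite -comp_preimage (_ : _ \o _ = id) ?preimage_id//; exact/funext.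
Qed.

HB.instance Definition _ := Measure_isSigmaFinite.Build _ _ _ cons_measure
  cons_measure_sigma_finite.

End cons_measure.

Fixpoint tuple_measure (n : nat) :
    {sigma_finite_measure set (n.-tuple T) -> \bar R} :=
  match n with
  | 0 => [the {sigma_finite_measure set (0.-tuple T) -> \bar R} of
            \d_([tuple] : 0.-tuple T)]
  | n'.+1 => [the {sigma_finite_measure set (n'.+1.-tuple T) -> \bar R} of
                cons_measure (tuple_measure n')]
  end.

Lemma tuple_measure_box n (A : 'I_n -> set T) :
  (forall i, measurable (A i)) ->
  tuple_measure n [set t | forall i, A i (tnth t i)] =
  (\prod_(i < n) mu (A i))%E.
Proof.
elim: n A => [|n IH] A mA.
  rewrite big_ord0 /= diracE mem_set//=.
  by case.
rewrite big_ord_recl/= -IH; last by move=> i; exact: mA.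
rewrite /cons_measure /pushforward.
rewrite (_ : _ @^-1` _ =
    A ord0 `*` [set t | forall i, A (lift ord0 i) (tnth t i)]).
  apply: product_measure1E => //.
  rewrite [X in measurable X](_ : _ =
      \bigcap_(i in [set: 'I_n])
        ((fun t : n.-tuple T => tnth t i) @^-1` A (lift ord0 i))).
    apply: fin_bigcap_measurable => // i _.
    by rewrite -[X in measurable X]setTI; exact: measurable_tnth.
  by apply/seteqP; split => [t At i _|t At i]; [exact: At|exact: At].
apply/seteqP; split => -[a t] /=.
  move=> H; split => [|i]; first exact: (H ord0).
  by have := H (lift ord0 i); rewrite tnthS.
move=> [Ha Ht] i; have [j ->|->] := unliftP ord0 i => //.
by rewrite tnthS.
Qed.

End tuple_measure.

Section euclidean_space.
Context (R : realType) (n : nat).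

(* The carrier is n.-tuple R, but with the sigma-algebra of all
   Lebesgue-measurable sets (not only the Borel sets). *)
Definition euclidean_space :=
  caratheodory_type ((tuple_measure (@lebesgue_measure R) n)^*)%mu.
HB.instance Definition _ := Measurable.on euclidean_space.

Definition lebesgue_measure_nd : set euclidean_space -> \bar R :=
  @completed_measure_extension _ _ _ (tuple_measure (@lebesgue_measure R) n).
HB.instance Definition _ := Measure.on lebesgue_measure_nd.

Let lebesgue_measure_nd_sigma_finite :
  sigma_finite setT lebesgue_measure_nd.
Proof. exact/completed_measure_extension_sigma_finite/sigma_finiteT. Qed.

HB.instance Definition _ := Measure_isSigmaFinite.Build _ _ _
  lebesgue_measure_nd lebesgue_measure_nd_sigma_finite.

Definition euclidean_norm (x : euclidean_space) : R :=
  Num.sqrt (\sum_(i < n) tnth x i ^+ 2).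

End euclidean_space.
Arguments lebesgue_measure_nd {R n}.

Definition Gamma (R : realType) (s : R) : R :=
  Rintegral (@lebesgue_measure R) `]0, +oo[ (fun t => t `^ (s - 1) * expR (- t)).

Definition hilbert_constant (R : realType) (n : nat) (p : R) : R :=
  n%:R * pi / sin (pi / p) * (pi `^ (n%:R / 2) / Gamma (n%:R / 2 + 1)).

Section hilbert_inequalities.
Context (R : realType) (n : nat).
Local Notation E := (euclidean_space R n).
Local Notation mu := (@lebesgue_measure_nd R n).
Local Notation "\| x |" := (euclidean_norm x) (at level 0, x at level 99).
Implicit Types (p q C : R) (f g : E -> R).

Definition nonneg_Lp p f := (forall x, 0 <= f x) /\ f \in Lfun mu p%:E.

Local Open Scope ereal_scope.

(* At the origin the values of `^ and / are junk, but only on a null set.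
   The iterated integrals are extended-real valued. *)
Definition hilbert_a p q C f g : Prop :=
  \int[mu]_y \int[mu]_x
    (f x * g y / (\|x| + \|y|)
       * \|x| `^ ((1 - n%:R) * (1 / q)) * \|y| `^ ((1 - n%:R) * (1 / p)))%:E
  <= C%:E * (\int[mu]_x (f x `^ p)%:E) `^ (1 / p)
          * (\int[mu]_y (g y `^ q)%:E) `^ (1 / q).

Definition hilbert_b p q C f : Prop :=
  (\int[mu]_y
     ((\int[mu]_x (f x / (\|x| + \|y|) * \|x| `^ ((1 - n%:R) * (1 / q)))%:E) `^ p
        * (\|y| `^ (1 - n%:R))%:E)) `^ (1 / p)
  <= C%:E * (\int[mu]_x (f x `^ p)%:E) `^ (1 / p).

Definition hilbert_c p q C g : Prop :=
  (\int[mu]_x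
     ((\int[mu]_y (g y / (\|x| + \|y|) * \|y| `^ ((1 - n%:R) * (1 / p)))%:E) `^ q
        * (\|x| `^ (1 - n%:R))%:E)) `^ (1 / q)
  <= C%:E * (\int[mu]_y (g y `^ q)%:E) `^ (1 / q).

End hilbert_inequalities.

(* Main.v *)
(** The kernel and both norms only see |x|, so polar coordinates reduce the
    inequalities to the one-dimensional integral
      \int_0^oo r^(-c) / (r + s) dr = s^(-c) * pi / sin (pi * c)   (0 < c < 1).
    With r = exp (- u) this is P c + P (1 - c) = pi / sin (pi * c) for
    P c = \int_0^oo exp (- c u) / (1 + exp (- u)) du. The difference h of the two
    sides is bounded, tends to 0 at 0, and satisfies
      3 * h c = h (c / 3) - h ((c + 1) / 3) + h ((c + 2) / 3),
    so sup |h| cannot be positive (a variant of Herglotz's trick).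

    Inequalities (b) and (c) are then Schur's test with the weight
    |x|^(n / (p * q)), and Hoelder's inequality together with duality makes each
    of them equivalent to (a), for any constant. For sharpness, (a) is tested on
    f = |x|^(-n/p) and g = |y|^(-n/q), both cut off to 1 <= |x| <= m^k, letting
    first k and then m tend to infinity.

    The volume V of the unit ball comes from two evaluations of the integral of
    exp (- |x|^2): it is pi^(n/2) by Fubini, and V * Gamma (n/2 + 1) by layer
    cake. *)
Require Import Defs.
From HB Require Import structures.
From mathcomp Require Import all_boot all_order all_algebra.
From mathcomp Require Import all_classical all_reals all_analysis.
From mathcomp Require Import measurable_realfun ring lra.

Set Implicit Arguments.
Unset Strict Implicit.
Unset Printing Implicit Defensive.
Import Order.TTheory GRing.Theory Num.Theory.
Import numFieldNormedType.Exports.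

Local Open Scope classical_set_scope.
Local Open Scope ring_scope.

(** * Measures with density and radial integrals *)

(** No measure on the sphere is constructed: the volumes of balls determine the law of |x|, which is
    all that radial integrands see. From Schur's test on, the space is an arbitrary sigma-finite
    measure with a function [norm], later subject to such a polar formula. Exchanging p and q
    transposes the kernel, so (c) is (b) for the exchanged pair. The exponent n/(p q) is symmetric
    in p and q and makes Schur's test lossless: the powers w^(-q) = |x|^(-n/p) and w^(-p) =
    |x|^(-n/q) satisfy its two conditions with equality off the origin. They miss L^p and L^q only
    by a logarithm, which is why their cutoffs nearly attain the constant. The factor n V in the
    constant is the area of the unit sphere. In the equivalences C is arbitrary, yet duality needs
    the transform of f to have a finite p-norm beforehand. Schur's test with the true constant
    supplies this finiteness, so the equivalences rest on it. *)

Section density.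
Local Open Scope ereal_scope.
Context d (T : measurableType d) (R : realType).
Variable mu : {measure set T -> \bar R}.

(** The proofs [mh] and [h0] are arguments so that the measure structure built from them can be
    inferred from the term itself. *)
Definition density_measure (h : T -> R)
    (mh : measurable_fun setT h) (h0 : forall x, (0 <= h x)%R) (A : set T) :=
  \int[mu]_(x in A) (h x)%:E.

Variables (h : T -> R) (mh : measurable_fun setT h).
Hypothesis h0 : forall x, (0 <= h x)%R.
Local Notation nu := (density_measure mh h0).

Let nu0 : nu set0 = 0.
Proof. by rewrite /density_measure integral_set0. Qed.

Let nu_ge0 A : 0 <= nu A.
Proof. by apply: integral_ge0 => x _; rewrite lee_fin. Qed.

Let nu_sigma_additive : semi_sigma_additive nu.
Proof.
move=> F mF tF mUF; rewrite /density_measure ge0_integral_bigcup//.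
- apply: is_cvg_ereal_nneg_natsum_cond => n _ _.
  by apply: integral_ge0 => x _; rewrite lee_fin.
- exact/measurable_EFinP/measurable_funTS.
- by move=> x _; rewrite lee_fin.
Qed.

HB.instance Definition _ := isMeasure.Build _ _ _ nu nu0 nu_ge0
  nu_sigma_additive.

Import HBNNSimple.

(** For simple functions this is linearity and the definition of the measure; monotone convergence
    on both sides gives the general case. *)
Lemma ge0_integral_density (f : T -> \bar R) :
  measurable_fun setT f -> (forall x, 0 <= f x) ->
  \int[nu]_x f x = \int[mu]_x (f x * (h x)%:E).
Proof.
move=> mf f0; pose f_ := nnsfun_approx measurableT mf.
have cvgf x : EFin \o f_^~ x @ \oo --> f x.
  by apply: cvg_nnsfun_approx => //.
transitivity (limn (fun n => \int[nu]_x (f_ n x)%:E)).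
  rewrite -monotone_convergence//.
  - by apply: eq_integral => y _; apply/esym/cvg_lim => //; exact: cvgf.
  - by move=> n; exact/measurable_EFinP/measurable_funP.
  - by move=> n y _; rewrite lee_fin.
  - by move=> y _ m n mn; rewrite lee_fin; exact/lefP/nd_nnsfun_approx.
transitivity (limn (fun n => \int[mu]_x ((f_ n x)%:E * (h x)%:E))); last first.
  rewrite -monotone_convergence//.
  - apply: eq_integral => y _; apply/cvg_lim => //.
    by apply: cvgeZr => //; exact: cvgf.
  - by move=> n; apply: emeasurable_funM; exact/measurable_EFinP.
  - by move=> n y _; rewrite mule_ge0 ?lee_fin.
  - move=> y _ m n mn; apply: lee_wpmul2r; first by rewrite lee_fin.
    by rewrite lee_fin; exact/lefP/nd_nnsfun_approx.
congr (limn _); apply/funext => n.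
under [LHS]eq_integral do rewrite fimfunE -fsumEFin//.
rewrite [LHS]ge0_integral_fsum//; last 2 first.
  - by move=> r; exact/measurable_EFinP/measurable_funM.
  - by move=> r x _; rewrite nnfun_muleindic_ge0.
transitivity (\int[mu]_x (\sum_(r \in range (f_ n))
    ((r * \1_(f_ n @^-1` [set r]) x)%:E * (h x)%:E))); last first.
  apply: eq_integral => x _; rewrite fimfunE -fsumEFin// ge0_mule_fsuml//.
  by move=> r; rewrite nnfun_muleindic_ge0.
rewrite ge0_integral_fsum//; last 2 first.
  - move=> r; apply: emeasurable_funM; last exact/measurable_EFinP.
    exact/measurable_EFinP/measurable_funM.
  - by move=> r x _; rewrite mule_ge0 ?lee_fin//= -lee_fin EFinM nnfun_muleindic_ge0.
apply: eq_fsbigr => r rf.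
have mfr : measurable (f_ n @^-1` [set r]) by [].
rewrite integralZl_indic_nnsfun// integral_indic// setIT.
have r0 : (0 <= r)%R by case/set_mem: rf => x _ <-.
under [RHS]eq_integral do rewrite EFinM -muleA.
rewrite ge0_integralZl//; last 2 first.
- by apply: emeasurable_funM; exact/measurable_EFinP.
- by move=> x _; rewrite mule_ge0 ?lee_fin.
congr (_ * _); rewrite /= /density_measure integral_mkcond.
by apply: eq_integral => x _; rewrite epatch_indic muleC.
Qed.

End density.

(** Real powers are measurable, but [powR] with exponent -1 is the inverse only for a nonnegative
    base; hence the form f (f^2)^(-1). At a zero of f both sides are 0, since the inverse of 0 is
    0. *)
Lemma measurable_funV d (T : measurableType d) (R : realType) (D : set T)
    (f : T -> R) :
  measurable_fun D f -> measurable_fun D (fun x => (f x)^-1).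
Proof.
move=> mf; rewrite (_ : (fun _ => _) = (fun x => f x * (f x ^+ 2) `^ (-1))).
  apply: measurable_funM => //.
  apply: (measurableT_comp (measurable_powR (-1))).
  exact: measurable_funX.
apply/funext => x; rewrite powR_inv1 ?sqr_ge0//.
by have [->|fx0] := eqVneq (f x) 0; [rewrite mul0r invr0|field].
Qed.

Section radial.
Local Open Scope ereal_scope.
Context (R : realType).
Local Notation leb := (@lebesgue_measure R).

Lemma integral_exprn (n : nat) (r : R) : (0 < r)%R ->
  \int[leb]_(t in `]0%R, r[) (n.+1%:R * t ^+ n)%:E = (r ^+ n.+1)%:E.
Proof.
move=> r0.
have d1 (t : R) : is_derive t 1%R (fun t : R => t ^+ n.+1)%R (n.+1%:R * t ^+ n)%R.
  have := @is_deriveX R R^o id n.+1 t 1%R 1%R (is_derive_id _ _).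
  by rewrite exprfctE /= [_ *: _]mulr1.
rewrite -(@integral_itv_bndoo _ _ _ _ true false); last first.
  apply/measurable_EFinP/measurable_funTS => /=.
  exact: measurable_funM.
rewrite (@continuous_FTC2 _ _ (fun t : R => t ^+ n.+1)%R)//.
- by rewrite expr0n/= sube0.
- apply: continuous_subspaceT => x.
  by apply: cvgM; [exact: cvg_cst|exact: exprn_continuous].
- split.
  + by move=> x _; exact: ex_derive.
  + by apply: cvg_at_right_filter; exact: exprn_continuous.
  + by apply: cvg_at_left_filter; exact: exprn_continuous.
- by move=> x _; rewrite derive1E derive_val.
Qed.

Let h (V : R) n (t : R) : R := (V * n.+1%:R * t ^+ n * \1_(`]0%R, +oo[) t)%R.

Let mh V n : measurable_fun setT (h V n).
Proof.
apply: measurable_funM; last exact: measurable_indic.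
exact: measurable_funM.
Qed.

Let h0 V n : (0 <= V)%R -> forall t : R, (0 <= h V n t)%R.
Proof.
move=> V0 t; rewrite /h indicE.
have [|_] := boolP (t \in _); last by rewrite mulr0.
rewrite inE/= in_itv/= andbT => t0.
by rewrite !mulr_ge0// exprn_ge0// ltW.
Qed.

Context d (T : measurableType d) (m : {measure set T -> \bar R}).
Variables (D : set T) (rho : T -> R) (V : R) (n : nat).
Hypothesis mD : measurable D.
Hypothesis mrho : measurable_fun setT rho.
Hypothesis rho0 : forall x, D x -> (0 <= rho x)%R.
Hypothesis Vrho : forall r : R, (0 < r)%R ->
  m (D `&` rho @^-1` `]-oo, r[) = (V * r ^+ n.+1)%:E.

(* The hypothesis says that the image measure of m by rho agrees on the half-lines
   `]-oo, r[ with the measure of density V * n.+1 * r ^+ n on `]0, +oo[. *)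
Lemma integral_radial (phi : R -> \bar R) :
  measurable_fun setT phi -> (forall r, 0 <= phi r) ->
  \int[m]_(x in D) phi (rho x) =
  \int[leb]_(r in `]0%R, +oo[) (phi r * (V * n.+1%:R * r ^+ n)%:E).
Proof.
move=> mphi phi0.
have V0 : (0 <= V)%R.
  by rewrite -lee_fin -[V]mulr1 -[X in (V * X)%R](expr1n R n.+1) -Vrho.
(* The restrictions to []0, +oo[] and to [D] are turned into densities, so that [nu] and [nu'] are
   both measures on the whole line. *)
pose nu : {measure set (measurableTypeR R) -> \bar R} := density_measure leb (mh V n) (h0 n V0).
have mD1 : measurable_fun setT (\1_D : T -> R) by exact: measurable_indic.
have D1 x : (0 <= \1_D x :> R)%R by rewrite indicE.
unshelve epose (nu' := (pushforward (density_measure m mD1 D1)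
  (rho : T -> measurableTypeR R) : {measure set (measurableTypeR R) -> \bar R})).
  exact: mrho.
have nu_val A : nu A = \int[leb]_(t in A) (h V n t)%:E by [].
have nu'_val A : nu' A = \int[m]_(x in rho @^-1` A) (\1_D x)%:E by [].
pose G := [set A : set R | exists x, A = `]-oo, x[%classic].
have nuG r : nu `]-oo, r[%classic = (V * (Num.max 0 r) ^+ n.+1)%:E.
  have [r0|r0] := leP r 0%R.
    rewrite expr0n mulr0 nu_val.
    rewrite integral0_eq// => t /=; rewrite in_itv/= => tr.
    by rewrite /h indicE memNset ?mulr0//= in_itv/= andbT; lra.
  rewrite EFinM -integral_exprn// -ge0_integralZl//; last 2 first.
  - apply/measurable_EFinP/measurable_funTS => /=.
    exact: measurable_funM.
  - move=> t /=; rewrite in_itv/= => /andP[t0 _].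
    by rewrite lee_fin mulr_ge0// exprn_ge0// ltW.
  rewrite nu_val [LHS]integral_mkcond [RHS]integral_mkcond.
  apply: eq_integral => t _; rewrite /h !patchE.
  have [t0|t0] := ltP 0%R t; have [tr|tr] := ltP t r.
  - rewrite !mem_set/= ?in_itv/= ?t0 ?tr// indicE mem_set/= ?in_itv/= ?t0//.
    by rewrite mulr1 -EFinM mulrA.
  - by rewrite !memNset//= in_itv/=; lra.
  - rewrite mem_set/= ?in_itv/=// memNset/= ?in_itv/=; last by lra.
    by rewrite indicE memNset ?mulr0//= in_itv/= andbT; lra.
  - by rewrite !memNset//= in_itv/=; lra.
have nu'G r : nu' `]-oo, r[%classic = (V * (Num.max 0 r) ^+ n.+1)%:E.
  rewrite nu'_val integral_indic//; last first.
    by rewrite -[X in measurable X]setTI; exact: mrho.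
  have [r0|r0] := leP r 0%R; last exact: Vrho.
  rewrite (_ : _ `&` _ = set0) ?measure0 ?expr0n ?mulr0//.
  apply/seteqP; split => // x [/rho0 x0]/=; rewrite in_itv/=; lra.
(* The half-lines are stable under intersection and generate the Borel sets; those ending at a
   natural number have finite measure and exhaust the line. Agreement on half-lines therefore forces
   equality. *)
have nuE A : measurable A -> nu' A = nu A.
  apply: (@measure_unique _ _ (measurableTypeR R) G
    (fun k => `]-oo, k%:R[%classic)) => //.
  - exact: RGenInftyO.measurableE.
  - move=> _ _ [x ->] [y ->]; exists (Num.min x y).
    by apply/seteqP; split => t /=; rewrite !in_itv/= lt_min;
      [move=> [-> ->]|move/andP].
  - by move=> i; exists i%:R.
  - apply/seteqP; split => // x _; exists (Num.bound `|x : R|) => //=.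
    by rewrite in_itv/= (le_lt_trans (ler_norm _) (archi_boundP (normr_ge0 _))).
  - by move=> _ [x ->]; rewrite nu'G nuG.
  - by move=> k; rewrite nu'G ltry.
transitivity (\int[nu']_r phi r).
  rewrite (@ge0_integral_pushforward _ _ _ (measurableTypeR R))//=.
  rewrite preimage_setT ge0_integral_density//.
  - rewrite [LHS]integral_mkcond; apply: eq_integral => x _.
    by rewrite patchE indicE; case: ifPn => _; rewrite ?mule1 ?mule0.
  - exact: measurableT_comp.
rewrite (eq_measure_integral nu)//; last by move=> A mA _; exact: nuE.
rewrite ge0_integral_density// [RHS]integral_mkcond.
apply: eq_integral => r _; rewrite /h patchE indicE.
by case: ifPn => _; rewrite ?mulr1// mulr0 mule0.
Qed.

End radial.

(** * The reflection formula *)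

(** For c > 0 this is the alternating series 1/c - 1/(c+1) + 1/(c+2) - ..., Nielsen's beta function.
    It is extended-valued, so no convergence has to be settled before the identities below. *)
HB.lock Definition expR_integral (R : realType) (c : R) : \bar R :=
  (\int[@lebesgue_measure R]_(u in `]0%R, +oo[)
    (expR (- (c * u)) / (1 + expR (- u)))%:E)%E.
Canonical locked_expR_integral := Unlockable expR_integral.unlock.

Section reflection_integral.
Local Open Scope ereal_scope.
Context (R : realType).
Local Notation leb := (@lebesgue_measure R).
Local Notation P := expR_integral.
Implicit Types (a b c k u : R).

Lemma integral_expRN a c : (0 < c)%R ->
  \int[leb]_(u in `[a, +oo[) (expR (- (c * u)))%:E = (expR (- (c * a)) / c)%:E.
Proof.
move=> c0.
have ce : continuous (fun u : R^o => expR (- c * u)).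
  move=> u; apply: continuous_comp; last exact: continuous_expR.
  by apply: continuousM => //; apply: (@continuousN _ R^o); exact: cst_continuous.
have -> : (expR (- (c * a)) / c = 0 - (- expR (- c * a) / c))%R.
  by rewrite sub0r mulNr opprK mulNr.
under eq_integral do rewrite -mulNr.
apply: (@ge0_continuous_FTC2y _ _ (fun u => - expR (- c * u) / c)%R a 0%R).
- by move=> *; exact: expR_ge0.
- exact: continuous_subspaceT.
- rewrite -(mul0r (c^-1)%R) -oppr0; apply: cvgMl; apply: cvgN.
  rewrite (_ : (fun x => expR (- c * x)) =
               (fun z => expR (- z)) \o (fun z => c * z)%R); last first.
    by apply: eq_fun => x; rewrite mulNr.
  apply: (@cvg_comp _ _ _ _ _ _ (pinfty_nbhs R)); last exact: cvgr_expR.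
  exact: gt0_cvgMry.
- by move=> u _.
- by apply: cvgMl; apply: cvgN; apply/cvg_at_right_filter; exact: ce.
- move=> u _.
  rewrite derive1Mr// derive1N// derive1_comp// derive1E.
  have /funeqP -> := @derive_expR R.
  by rewrite derive1Ml// derive1_id mulr1 mulrN opprK mulfK// gt_eqF.
Qed.

(** An instance of [integral_radial]: the image of the half-line under u -> k u has constant density
    1/k. *)
Lemma ge0_integral_scale k (phi : R -> \bar R) : (0 < k)%R ->
  measurable_fun setT phi -> (forall r, 0 <= phi r) ->
  k%:E * \int[leb]_(u in `]0%R, +oo[) phi (k * u)%R =
  \int[leb]_(u in `]0%R, +oo[) phi u.
Proof.
move=> k0 mphi phi0.
rewrite (@integral_radial _ _ _ leb `]0%R, +oo[%classic (fun u => k * u)%R k^-1 0)//.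
- under eq_integral do rewrite expr0 !mulr1 muleC.
  rewrite ge0_integralZl ?lee_fin ?invr_ge0 ?(ltW k0)//.
    by rewrite muleA -EFinM divff ?gt_eqF// mul1e.
  exact: measurable_funTS.
- exact: measurable_funM.
- by move=> u /=; rewrite in_itv/= andbT => u0; rewrite mulr_ge0// ltW.
- move=> r r0; rewrite (_ : _ `&` _ = `]0%R, (r / k)%R[%classic).
    rewrite [LHS]lebesgue_measure_itv/= lte_fin divr_gt0//.
    by rewrite expr1 oppr0 adde0 mulrC.
  apply/seteqP; split => u /=; rewrite !in_itv/= ltr_pdivlMr// andbT mulrC.
    by move=> [-> ->].
  by move=> /andP.
Qed.

Lemma ge0_integral_line (f : R -> \bar R) :
  measurable_fun setT f -> (forall u, 0 <= f u) ->
  \int[leb]_u f u = \int[leb]_(u in `]0%R, +oo[) f u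
                   + \int[leb]_(u in `]0%R, +oo[) f (- u)%R.
Proof.
move=> mf f0; have mfN : measurable_fun setT (fun u => f (- u)%R).
  exact: (measurableT_comp mf).
rewrite -(setUv `]0%R, +oo[%classic) ge0_integral_setU//=; last 3 first.
- exact: measurableC.
- by rewrite setUv.
- exact/disj_setPCl.
congr (_ + _).
rewrite setCitvr integral_itv_obnd_cbnd; last exact: measurable_funTS.
rewrite (@ge0_integration_by_substitution0 _ (fun u => f (- u)%R))//.
by apply: eq_integral => u _; rewrite opprK.
Qed.

Let mexp (f : R -> R) : measurable_fun setT f ->
  measurable_fun setT (fun u => expR (f u)).
Proof. exact: measurableT_comp. Qed.

Let mlin c : measurable_fun setT (fun u => expR (- (c * u))).
Proof. by apply: mexp; apply: measurableT_comp => //; exact: measurable_funM. Qed.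

Let mden : measurable_fun setT (fun u => (1 + expR (- u))^-1)%R.
Proof.
apply: measurable_funV.
by apply: measurable_funD => //; apply: mexp.
Qed.

Let mP c : measurable_fun setT (fun u => (expR (- (c * u)) / (1 + expR (- u)))%:E).
Proof. by apply/measurable_EFinP/measurable_funM. Qed.

Let P_ge0' c u : 0 <= (expR (- (c * u)) / (1 + expR (- u)))%:E.
Proof. by rewrite lee_fin divr_ge0 ?addr_ge0 ?expR_ge0. Qed.

Lemma expR_integral_ge0 c : 0 <= P c.
Proof. by rewrite unlock; exact: integral_ge0. Qed.

(** The sum of the two numerators contains the factor 1 + exp (- u), which cancels the denominator.
    This isolates the pole 1/c and also shows that P c is finite. *)
Lemma expR_integral_recl c : (0 < c)%R -> P c + P (c + 1)%R = (c^-1)%:E.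
Proof.
move=> c0; rewrite unlock -ge0_integralD//; last 2 first.
- by apply: measurable_funTS; exact: mP.
- by apply: measurable_funTS; exact: mP.
transitivity (\int[leb]_(u in `]0%R, +oo[) (expR (- (c * u)))%:E).
  apply: eq_integral => u _; rewrite -EFinD; congr EFin.
  have -> : (- ((c + 1) * u) = - (c * u) - u)%R by ring.
  rewrite expRD; have := expR_gt0 (- u).
  by move=> x0; field; rewrite gt_eqF// addr_gt0.
rewrite integral_itv_obnd_cbnd; last first.
  by apply/measurable_EFinP/measurable_funTS; exact: mlin.
by rewrite integral_expRN// mulr0 oppr0 expR0 mul1r.
Qed.

Lemma expR_integral_antitone a b : (a <= b)%R -> P b <= P a.
Proof.
move=> ab; rewrite unlock; apply: ge0_le_integral => //.
- by apply: measurable_funTS; exact: mP.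
- by apply: measurable_funTS; exact: mP.
- move=> u /=; rewrite in_itv/= andbT => u0.
  rewrite lee_fin ler_pM2r ?invr_gt0 ?ltr_wpDr ?expR_ge0//.
  by rewrite ler_expR lerN2 ler_pM2r.
Qed.

(** With x = exp (- u), 1/(1 + x) = (1 - x + x^2)/(1 + x^3); the substitution u -> 3 u identifies
    the three terms on the right. The negative one is moved to the other side because subtraction is
    delicate in the extended reals. *)
Lemma expR_integral_triple c :
  P (c / 3) + P ((c + 2) / 3) = 3%:E * P c + P ((c + 1) / 3)%R.
Proof.
pose Q x := \int[leb]_(u in `]0%R, +oo[)
  (expR (- (x * (3 * u))) / (1 + expR (- (3 * u))))%:E.
have Q_ge0 x : 0 <= Q x by apply: integral_ge0 => u _; exact: P_ge0'.
have PQ x : P x = 3%:E * Q x.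
  by rewrite unlock -(@ge0_integral_scale 3%R _ _ (mP x) (P_ge0' x)).
have mQ (x : R) : measurable_fun (`]0%R, +oo[%classic : set R)
    (fun u : R => (expR (- (x * (3 * u))) / (1 + expR (- (3 * u))))%:E).
  by apply: measurable_funTS; exact: (measurableT_comp (mP x)).
have QP : Q (c / 3)%R + Q ((c + 2) / 3)%R = P c + Q ((c + 1) / 3)%R.
  rewrite /Q -[LHS]ge0_integralD//; [|exact: mQ|exact: mQ].
  rewrite unlock -[RHS]ge0_integralD//;
    [|by apply: measurable_funTS; exact: mP|exact: mQ].
  apply: eq_integral => u _; rewrite -!EFinD; congr EFin.
  have -> : (- (c / 3 * (3 * u)) = - (c * u))%R by field.
  have -> : (- ((c + 1) / 3 * (3 * u)) = - (c * u) - u)%R by field.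
  have -> : (- ((c + 2) / 3 * (3 * u)) = - (c * u) - u - u)%R by field.
  have -> : (- (3 * u) = - u - u - u)%R by ring.
  rewrite !expRD; have := expR_gt0 (- u).
  set x := expR (- u); set y := expR _ => x0.
  have h1 : (1 + x != 0)%R by rewrite gt_eqF// addr_gt0.
  have h3 : (1 + x * x * x != 0)%R by rewrite gt_eqF// addr_gt0// !mulr_gt0.
  by field; apply/andP; split.
by rewrite (PQ (c / 3)%R) (PQ ((c + 2) / 3)%R) (PQ ((c + 1) / 3)%R)
  -ge0_muleDr// QP ge0_muleDr// expR_integral_ge0.
Qed.

End reflection_integral.

(** * Bounds and a triplication formula for the cosecant *)

Section cosecant.
Context (R : realType).
Implicit Types x c : R.

(** By the mean value theorem sin x = x cos c for some c in ]0, x[, and the cosine decreases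
    there. *)
Lemma sin_between x : 0 < x <= pi / 2 -> x * cos x <= sin x <= x.
Proof.
move=> /andP[x0 xpi].
have [c] := @MVT R (@sin R) (@cos R) 0 x x0 (fun y _ => is_derive_sin y)
  (continuous_subspaceT (@continuous_sin R)).
rewrite in_itv/= sin0 !subr0 => /andP[c0 cx] ->.
rewrite mulrC ler_pM2r// ler_piMl ?cos_le1 ?(ltW x0)// andbT leNgt ltr_cos ?in_itv/=; last 2 first.
- by rewrite (ltW x0)/=; have := @pi_gt0 R; lra.
- by rewrite (ltW c0)/=; have := @pi_gt0 R; lra.
by rewrite -leNgt ltW.
Qed.

(** Write s and c for the sine and cosine of x. Then x - s <= x (1 - c), and 1 - c <= 1 - c^2 = s^2
    <= s x because 0 <= c <= 1. Dividing x - s <= x (s x) by s x gives the bound. *)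
Lemma cosecant_expansion x : 0 < x <= pi / 2 ->
  0 <= (sin x)^-1 - x^-1 <= x.
Proof.
move=> xpi; have /andP[sl su] := sin_between xpi.
move: xpi => /andP[x0 xpi].
have pi0 := @pi_gt0 R.
have s0 : 0 < sin x by apply: sin_gt0_pi; lra.
have c0 : 0 <= cos x by apply: cos_ge0_pihalf; lra.
have := cos2Dsin2 x.
move: (sin x) (cos x) sl su s0 c0 => s c sl su s0 c0 cs.
have -> : s^-1 - x^-1 = (x - s) / (s * x) by field; lra.
have sx0 : 0 < s * x by rewrite mulr_gt0.
apply/andP; split; first by rewrite divr_ge0 ?subr_ge0// ltW.
rewrite ler_pdivrMr//.
have c1 : c <= 1 by nra.
have cs1 : 1 - c <= s * s by nra.
have cs2 : s * s <= s * x by nra.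
have : x * (1 - c) <= x * (s * x) by rewrite ler_pM2l//; lra.
lra.
Qed.

(** The two shifted sines differ by sin x and have product (3 - 4 sin^2 x)/4, so their reciprocals
    contribute 4 sin x / (3 - 4 sin^2 x); the claim then follows from sin (3 x) = sin x (3 - 4 sin^2
    x). *)
Lemma cosecant_triple x : 0 < x -> x < pi / 3 ->
  3 / sin (3 * x) =
  (sin x)^-1 - (sin (x + pi / 3))^-1 + (sin (x + 2 * pi / 3))^-1.
Proof.
move=> x0 xpi; have pi0 := @pi_gt0 R.
have s1 : 0 < sin x by apply: sin_gt0_pi; lra.
have s2 : 0 < sin (x + pi / 3) by apply: sin_gt0_pi; lra.
have s3 : 0 < sin (x + 2 * pi / 3) by apply: sin_gt0_pi; lra.
have s4 : 0 < sin (3 * x) by apply: sin_gt0_pi; lra.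
have r0 : 0 < sin (pi / 3 : R) by apply: sin_gt0_pi; lra.
have cos3 : cos (pi / 3 : R) = 1 / 2.
  have : sin (pi / 3 *+ 2 : R) = sin (pi / 3 : R).
    have -> : pi / 3 *+ 2 = pi - pi / 3 :> R by rewrite mulr2n; field.
    by rewrite sinB sinpi cospi; lra.
  rewrite sin_mulr2n mulr2n => h.
  apply: (mulfI (lt0r_neq0 r0)); lra.
have r2 := cos2Dsin2 (pi / 3 : R); rewrite cos3 in r2.
have E2 : sin (x + pi / 3) = sin x / 2 + cos x * sin (pi / 3).
  by rewrite sinD cos3; field.
have E3 : sin (x + 2 * pi / 3) = - sin x / 2 + cos x * sin (pi / 3).
  have -> : x + 2 * pi / 3 = (x - pi / 3) + pi by field.
  by rewrite sinDpi sinB cos3; field.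
have E4 : sin (3 * x) = sin x * (3 - 4 * sin x ^+ 2).
  have -> : 3 * x = x *+ 2 + x by rewrite mulr2n; ring.
  rewrite sinD sin_mulr2n cos_mulr2n !mulr2n.
  have := cos2Dsin2 x; move: (sin x) (cos x) => s c cs.
  have -> : c ^+ 2 = 1 - s ^+ 2 by lra.
  transitivity (2 * s * c ^+ 2 + (1 - s ^+ 2 + (1 - s ^+ 2) - 1) * s); first by ring.
  have -> : c ^+ 2 = 1 - s ^+ 2 by lra.
  by ring.
have cs := cos2Dsin2 x.
rewrite E2 in s2 *; rewrite E3 in s3 *; rewrite E4 in s4 *.
move: (sin x) (cos x) (sin (pi / 3)) cs s1 s2 s3 s4 r0 r2 => s c r cs s1 s2 s3 s4 r0 r2.
have n4 : 0 < 3 - 4 * s ^+ 2 by move: s4; rewrite pmulr_rgt0.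
have prod : (s / 2 + c * r) * (- s / 2 + c * r) = (3 - 4 * s ^+ 2) / 4.
  transitivity (c ^+ 2 * r ^+ 2 - s ^+ 2 / 4); first by field.
  have -> : c ^+ 2 = 1 - s ^+ 2 by lra.
  have -> : r ^+ 2 = 3 / 4 by lra.
  by field.
have -> : s^-1 - (s / 2 + c * r)^-1 + (- s / 2 + c * r)^-1 =
   s^-1 + s / ((s / 2 + c * r) * (- s / 2 + c * r)).
  by field; rewrite !gt_eqF//; nra.
by rewrite prod; field; rewrite !gt_eqF//; nra.
Qed.

End cosecant.

(** * Herglotz's trick, for a real function [p] (not an exponent here) *)

Section reflection.
Context (R : realType) (p : R -> R).
Implicit Types x c M : R.
Hypothesis p_antitone : forall a b, 0 < a -> a <= b -> p b <= p a.
Hypothesis p_rec : forall c, 0 < c -> p c + p (c + 1) = c^-1.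
Hypothesis p_triple : forall c, 0 < c ->
  p (c / 3) + p ((c + 2) / 3) = 3 * p c + p ((c + 1) / 3).

Let h c := p c + p (1 - c) - pi / sin (pi * c).

Let h_sym c : h (1 - c) = h c.
Proof.
rewrite /h subKr [p c + _]addrC; congr (_ - _ / _).
by rewrite mulrBr mulr1 addrC sinDpi sinN opprK.
Qed.

(** The reflection c -> 1 - c permutes the three points: 1 - c/3 = ((1-c)+2)/3, and so on. Hence
    [p_triple] at c and at 1 - c add up to the required identity, with [cosecant_triple] at pi c/3
    for the sine part. *)
Let h_triple c : 0 < c < 1 ->
  3 * h c = h (c / 3) - h ((c + 1) / 3) + h ((c + 2) / 3).
Proof.
move=> /andP[c0 c1]; rewrite /h.
have e1 : 1 - c / 3 = ((1 - c) + 2) / 3 by field.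
have e2 : 1 - (c + 1) / 3 = ((1 - c) + 1) / 3 by field.
have e3 : 1 - (c + 2) / 3 = (1 - c) / 3 by field.
have t1 := p_triple c0.
have t2 : _ := @p_triple (1 - c) ltac:(lra).
rewrite e1 e2 e3.
have pi0 := @pi_gt0 R.
have := @cosecant_triple R (pi * c / 3) ltac:(nra) ltac:(nra).
have -> : 3 * (pi * c / 3) = pi * c by field.
have -> : pi * c / 3 + pi / 3 = pi * ((c + 1) / 3) by field.
have -> : pi * c / 3 + 2 * pi / 3 = pi * ((c + 2) / 3) by field.
have -> : pi * c / 3 = pi * (c / 3) by field.
move=> t3.
have := congr1 (fun z => pi * z) t3; rewrite /=; lra.
Qed.

(** The recurrence at c removes the pole: h c = (p (1 - c) - p (1 + c)) - (pi / sin (pi c) - 1/c).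
    Both brackets are nonnegative. By the recurrence at 1 - c and 1 + c and monotonicity, the first
    is at most 1/(1-c) - 1/(1+c) = 2c/(1-c^2) <= 4c; by [cosecant_expansion] the second is at most
    pi^2 c. *)
Let h_small c : 0 < c -> c <= 1 / 2 -> `|h c| <= (4 + pi ^+ 2) * c.
Proof.
move=> c0 c2; have pi0 := @pi_gt0 R.
have r1 := p_rec c0.
have r2 := @p_rec (1 - c) ltac:(lra).
have r3 := @p_rec (1 + c) ltac:(lra).
have a1 := @p_antitone (1 - c) (1 + c) ltac:(lra) ltac:(lra).
have a2 := @p_antitone (1 - c + 1) (1 + c + 1) ltac:(lra) ltac:(lra).
have b : (1 - c)^-1 - (1 + c)^-1 <= 4 * c.
  have -> : (1 - c)^-1 - (1 + c)^-1 = (2 * c) / (1 - c ^+ 2).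
    by field; rewrite !gt_eqF//; nra.
  by rewrite ler_pdivrMr; nra.
have /andP[s1 s2] := @cosecant_expansion R (pi * c) ltac:(apply/andP; split; nra).
have e : pi / sin (pi * c) - c^-1 = pi * ((sin (pi * c))^-1 - (pi * c)^-1).
  by rewrite mulrBr invfM mulrA divff ?gt_eqF// mul1r.
have e0 : 0 <= pi / sin (pi * c) - c^-1 by rewrite e mulr_ge0// ltW.
have e1 : pi / sin (pi * c) - c^-1 <= pi ^+ 2 * c.
  by rewrite e expr2 -mulrA ler_pM2l.
rewrite (addrC c 1) in r1.
have pc : 0 <= 4 * c by nra.
have pc2 : 0 <= pi ^+ 2 * c by apply: mulr_ge0; [exact: sqr_ge0|exact: ltW].
rewrite ler_norml mulrDl /h; apply/andP; split; lra.
Qed.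

Let h_bounded c : 0 < c < 1 -> `|h c| <= 4 + pi ^+ 2.
Proof.
move=> /andP[c0 c1].
have pi2 : 0 <= 4 + pi ^+ 2 :> R by rewrite addr_ge0// sqr_ge0.
have [c2|c2] := leP c (1 / 2).
  by apply: (le_trans (h_small c0 c2)); nra.
rewrite -h_sym; apply: (le_trans (h_small _ _)); [lra|lra|nra].
Qed.

(** One triplication step, with the last two terms bounded by M, gives |h c| <= M - (M - |h
    (c/3)|)/3. Iterating along c -> c/3 only, the gap below M at c is at least 3^(-k) times the gap
    at c 3^(-k). *)
Let h_iter M : (forall c, 0 < c < 1 -> `|h c| <= M) -> forall k c, 0 < c < 1 ->
  `|h c| <= M - 3 ^- k * M + 3 ^- k * `|h (c * 3 ^- k)|.
Proof.
move=> hM; elim=> [|k IH] c /andP[c0 c1].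
  by rewrite expr0 invr1 mulr1 !mul1r subrr add0r.
have c3 : 0 < c / 3 < 1 by apply/andP; split; lra.
have := IH (c / 3) c3.
rewrite -mulrA -invfM -exprS.
have -> : 3 ^- k.+1 = 3 ^- k / 3 :> R by rewrite exprSr invfM mulrC.
set y := `|h (c / 3 ^+ k.+1)|; set t := 3 ^- k.
have hc := h_triple (introT andP (conj c0 c1)).
have h1 := hM ((c + 1) / 3) ltac:(apply/andP; split; lra).
have h2 := hM ((c + 2) / 3) ltac:(apply/andP; split; lra).
have h3 : 3 * `|h c| <= `|h (c / 3)| + `|h ((c + 1) / 3)| + `|h ((c + 2) / 3)|.
  have -> : 3 * `|h c| = `|3 * h c| by rewrite normrM [`|3|]ger0_norm.
  rewrite hc (le_trans (ler_normD _ _))// lerD2r.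
  exact: ler_normB.
move=> h4; lra.
Qed.

Lemma reflection_formula c : 0 < c < 1 -> p c + p (1 - c) = pi / sin (pi * c).
Proof.
move=> c01; apply/eqP; rewrite -subr_eq0 -normr_le0 leNgt -/(h c); apply/negP => hc.
pose E := [set `|h x| | x in [set x : R | 0 < x < 1]].
have supE : has_sup E.
  split; first by exists `|h c|, c.
  by exists (4 + pi ^+ 2) => _ [x x01 <-]; exact: h_bounded.
set M := sup E.
have hM x : 0 < x < 1 -> `|h x| <= M.
  by move=> x01; apply: (sup_upper_bound supE); exists x.
have M0 : 0 < M by rewrite (lt_le_trans hc)// hM.
pose B : R := 4 + pi ^+ 2.
have B0 : 0 < B by rewrite ltr_pwDl// sqr_ge0.
(* This k makes |h (x 3^(-k-1))| <= M/2 for all x at once, so the gap below M is uniform and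
   contradicts M being the supremum, attained or not. The successor guarantees x 3^(-k-1) <= 1/3,
   within reach of [h_small]. *)
have [k Bk] : exists k : nat, 2 * B / M < 3 ^+ k.+1.
  exists (Num.truncn (2 * B / M)).
  rewrite (lt_le_trans (truncnS_gt _))//.
  rewrite -natrX ler_nat ltnW// ltn_expl//.
have t0 : 0 < 3 ^- k.+1 :> R by rewrite invr_gt0 exprn_gt0.
have k2 : B * 3 ^- k.+1 <= M / 2.
  rewrite ler_pdivrMr ?exprn_gt0//.
  by move: Bk; rewrite ltr_pdivrMr//; lra.
have : M <= M - 3 ^- k.+1 * (M / 2).
  apply: ge_sup; first by case: supE.
  move=> _ [x x01 <-].
  apply: (le_trans (h_iter hM k.+1 x01)).
  case/andP: x01 => x0 x1.
  have x3 : 0 < x * 3 ^- k.+1 by rewrite mulr_gt0.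
  have x2 : x * 3 ^- k.+1 <= 1 / 2.
    rewrite exprS invfM mulrCA mulrA.
    have : 3 ^- k <= 1 :> R by rewrite invf_le1 ?exprn_gt0// exprn_ege1// ler1n.
    have : 0 < 3 ^- k :> R by rewrite invr_gt0 exprn_gt0.
    move: (3 ^- k) => t {}t0 t1; rewrite -mulrA.
    have : x * t <= 1 by nra.
    by lra.
  have := h_small x3 x2; rewrite -/B => hx.
  have : B * (x * 3 ^- k.+1) <= M / 2.
    by apply: le_trans k2; rewrite ler_pM2l// ler_piMl// ltW.
  move: (3 ^- k.+1) t0 hx => t t0 hx hy; nra.
have : 0 < 3 ^- k.+1 * (M / 2) by rewrite mulr_gt0// divr_gt0.
lra.
Qed.

End reflection.

(** * The integral of r^(-c)/(r + s) over the half-line *)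

Section stieltjes.
Local Open Scope ereal_scope.
Context (R : realType).
Local Notation leb := (@lebesgue_measure R).
Local Notation P := expR_integral.
Implicit Types (a b c k u : R).

(** The measure exp (- u) du gives mass r to the set where exp (- u) < r, so its image under u ->
    exp (- u) is Lebesgue measure on the positive half-line; [integral_radial] applies with V = 1
    and n = 0. *)
Lemma ge0_integral_expN (phi : R -> \bar R) :
  measurable_fun setT phi -> (forall r, 0 <= phi r) ->
  \int[leb]_(r in `]0%R, +oo[) phi r =
  \int[leb]_u (phi (expR (- u)) * (expR (- u))%:E).
Proof.
move=> mphi phi0.
have mh : measurable_fun setT (fun u : R => expR (- u)).
  exact: (measurableT_comp (@measurable_expR R)).
have h0 (u : R) : (0 <= expR (- u))%R by exact: expR_ge0.
rewrite -(@ge0_integral_density _ _ _ leb _ mh h0 (fun u => phi (expR (- u))))//;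
  last exact: (measurableT_comp mphi).
rewrite (@integral_radial R _ _ (density_measure leb mh h0) setT
  (fun u => expR (- u)) 1%R 0)//.
- by apply: eq_integral => r _; rewrite expr0 !mulr1 mule1.
- move=> r r0; rewrite setTI expr1 mul1r.
  transitivity (\int[leb]_(u in `](- ln r)%R, +oo[) (expR (- u))%:E).
    rewrite /= /density_measure; congr (integral _ _ _).
    have e u : (expR (- u) < r)%R = (- ln r < u)%R.
      by rewrite -[X in (_ < X)%R]lnK ?posrE// ltr_expR ltrNl.
    by apply/seteqP; split => u /=; rewrite !in_itv/= andbT e.
  rewrite integral_itv_obnd_cbnd; last exact/measurable_EFinP/measurable_funTS.
  under eq_integral do rewrite -[X in expR (- X)]mul1r.
  by rewrite integral_expRN// mul1r opprK lnK// divr1.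
Qed.

Lemma expR_integral_fin_num c : (0 < c)%R -> P c \is a fin_num.
Proof.
move=> c0; rewrite ge0_fin_numE ?expR_integral_ge0//.
by rewrite (@le_lt_trans _ _ (c^-1)%:E) ?ltry// -expR_integral_recl// leeDl// expR_integral_ge0.
Qed.

Lemma expR_integral_reflection c : (0 < c < 1)%R ->
  P c + P (1 - c)%R = (pi / sin (pi * c))%:E.
Proof.
move=> c01; have /andP[c0 c1] := c01.
rewrite -(@reflection_formula R (fun x => fine (P x)))// ?EFinD ?fineK ?expR_integral_fin_num ?subr_gt0//.
- move=> a b a0 ab; rewrite fine_le ?expR_integral_antitone ?expR_integral_fin_num//.
  exact: lt_le_trans ab.
- move=> a a0; rewrite -fineD ?expR_integral_recl ?expR_integral_fin_num ?addr_gt0//.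
- move=> a a0.
  have a1 : (0 < a / 3)%R by rewrite divr_gt0.
  have a2 : (0 < (a + 1) / 3)%R by rewrite divr_gt0 ?addr_gt0.
  have a3 : (0 < (a + 2) / 3)%R by rewrite divr_gt0 ?addr_gt0.
  have := expR_integral_triple a.
  rewrite -[P a]fineK ?expR_integral_fin_num// -[P (a / 3)]fineK ?expR_integral_fin_num//.
  rewrite -[P ((a + 1) / 3)]fineK ?expR_integral_fin_num//.
  rewrite -[P ((a + 2) / 3)]fineK ?expR_integral_fin_num//.
  by rewrite -EFinM -!EFinD => -[].
Qed.

Lemma measurable_powR_kernel c k :
  measurable_fun setT (fun r : R => r `^ (- c) / (r + k))%R.
Proof.
apply: measurable_funM => //.
by apply: measurable_funV; exact: measurable_funD.
Qed.

Let mabs c k :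
  measurable_fun [set: R] (fun r : R => (`|r `^ (- c) / (r + k)|)%:E).
Proof.
apply/measurable_EFinP.
exact: (measurableT_comp (@normr_measurable R setT) (measurable_powR_kernel c k)).
Qed.

(* The absolute value only makes the integrand nonnegative on the whole line. *)
Lemma integral_powR_kernel1 c : (0 < c < 1)%R ->
  \int[leb]_(r in `]0%R, +oo[) (`|r `^ (- c) / (r + 1)|)%:E = (pi / sin (pi * c))%:E.
Proof.
move=> c01; rewrite -expR_integral_reflection// ge0_integral_expN//.
pose f u : \bar R := (expR (- ((1 - c) * u)) / (1 + expR (- u)))%:E.
have f0 u : 0 <= f u.
  by rewrite lee_fin divr_ge0 ?addr_ge0 ?expR_ge0.
have mf : measurable_fun setT f.
  apply/measurable_EFinP; apply: measurable_funM.
    apply: (measurableT_comp (@measurable_expR R)).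
    by apply: measurableT_comp => //; exact: measurable_funM.
  apply: measurable_funV; apply: measurable_funD => //.
  exact: (measurableT_comp (@measurable_expR R)).
transitivity (\int[leb]_u f u).
  apply: eq_integral => u _; rewrite -EFinM; congr EFin.
  have e0 := expR_gt0 (- u).
  rewrite ger0_norm ?divr_ge0 ?powR_ge0 ?addr_ge0 ?expR_ge0//.
  rewrite -expRM /f.
  have -> : (- ((1 - c) * u) = - u * - c + - u)%R by ring.
  by rewrite expRD [(_ + 1)%R]addrC mulrAC.
(* The half-line u > 0 gives P (1 - c). On the other half, after u -> - u, the integrand exp ((1-c)
   u)/(1 + exp u) equals exp (- c u)/(1 + exp (- u)), which gives P c. *)
rewrite ge0_integral_line// addeC unlock; congr (_ + _).
apply: eq_integral => u _; congr EFin.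
have -> : (- ((1 - c) * - u) = - (c * u) + u)%R by ring.
rewrite opprK expRD (expRN u); have := expR_gt0 u.
by move=> x0; field; rewrite !gt_eqF// addr_gt0.
Qed.

Lemma integral_powR_kernel c k : (0 < c < 1)%R -> (0 < k)%R ->
  \int[leb]_(r in `]0%R, +oo[) (r `^ (- c) / (r + k))%:E =
  (k `^ (- c) * (pi / sin (pi * c)))%:E.
Proof.
move=> c01 k0.
transitivity (\int[leb]_(r in `]0%R, +oo[) (`|r `^ (- c) / (r + k)|)%:E).
  apply: eq_integral => r /[!inE]/=; rewrite in_itv/= andbT => r0.
  by rewrite ger0_norm// divr_ge0 ?powR_ge0 ?addr_ge0 ?ltW.
rewrite -(ge0_integral_scale k0)//.
rewrite EFinM -integral_powR_kernel1// -!ge0_integralZl//; last 4 first.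
- by apply: measurable_funTS; exact: mabs.
- by rewrite lee_fin powR_ge0.
- by apply: measurable_funTS; apply: (measurableT_comp (mabs c k)).
- by rewrite lee_fin ltW.
apply: eq_integral => r /[!inE]/=; rewrite in_itv/= andbT => r0.
rewrite -!EFinM; congr EFin.
rewrite !ger0_norm ?divr_ge0 ?powR_ge0 ?addr_ge0 ?mulr_ge0 ?ltW//.
rewrite powRM ?ltW//; field.
by rewrite !gt_eqF ?addr_gt0 ?mulr_gt0.
Qed.

End stieltjes.

(** * Polar coordinates *)

Section tuple_integral.
Local Open Scope ereal_scope.
Context (R : realType).
Local Notation leb := (@lebesgue_measure R).
Local Notation tau := (tuple_measure leb).

Lemma ge0_integral_tupleS n (F : n.+1.-tuple (measurableTypeR R) -> \bar R) :
  measurable_fun setT F -> (forall t, 0 <= F t) ->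
  \int[tau n.+1]_t F t = \int[leb]_a \int[tau n]_t F (cons_pair (a, t)).
Proof.
move=> mF F0.
rewrite (@ge0_integral_pushforward _ _ _ _ R (@cons_pair _ _ n))//=.
- rewrite preimage_setT fubini_tonelli1//.
  by apply: (measurableT_comp mF); exact: measurable_cons_pair.
- exact: measurable_cons_pair.
Qed.

(** The squared norm is additive over coordinates, so inductions on the dimension can peel off one
    coordinate. It lives on the product sigma-algebra, where Tonelli applies; the completed one
    comes in only with the polar coordinates. *)
Definition sqnorm n (t : n.-tuple (measurableTypeR R)) : R :=
  (\sum_(i < n) tnth t i ^+ 2)%R.

Lemma measurable_sqnorm n : measurable_fun setT (@sqnorm n).
Proof.
apply: measurable_sum => i; apply: measurable_funX; exact: measurable_tnth.
Qed.

Lemma sqnorm_ge0 n (t : n.-tuple (measurableTypeR R)) : (0 <= sqnorm t)%R.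
Proof. by apply: sumr_ge0 => i _; exact: sqr_ge0. Qed.

Lemma sqnorm_cons n (a : R) (t : n.-tuple (measurableTypeR R)) :
  sqnorm (cons_pair (a, t)) = (a ^+ 2 + sqnorm t)%R.
Proof.
by rewrite /sqnorm big_ord_recl; congr (_ + _)%R; apply: eq_bigr => i _; rewrite tnthS.
Qed.

Lemma ge0_integral_line_scale (k : R) (f : R -> \bar R) : (0 < k)%R ->
  measurable_fun setT f -> (forall u, 0 <= f u) ->
  k%:E * \int[leb]_u f (k * u)%R = \int[leb]_u f u.
Proof.
move=> k0 mf f0.
have mfN : measurable_fun setT (fun u : R => f (- u)%R).
  exact: (measurableT_comp mf).
rewrite ge0_integral_line//; last exact: (measurableT_comp mf).
rewrite ge0_muleDr ?integral_ge0// [RHS]ge0_integral_line//.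
rewrite (ge0_integral_scale k0 mf)//; congr (_ + _).
rewrite -[RHS](ge0_integral_scale k0 mfN)//; congr (_ * _).
by apply: eq_integral => u _; rewrite mulrN.
Qed.

Lemma ge0_integral_sqnormS n (phi : R -> \bar R) :
  measurable_fun setT phi -> (forall r, 0 <= phi r) ->
  \int[tau n.+1]_t phi (sqnorm t) =
  \int[leb]_a \int[tau n]_t phi (a ^+ 2 + sqnorm t)%R.
Proof.
move=> mphi phi0; rewrite ge0_integral_tupleS//.
- by apply: eq_integral => a _; apply: eq_integral => t _; rewrite sqnorm_cons.
- by apply: (measurableT_comp mphi); exact: measurable_sqnorm.
Qed.

Lemma measurable_integral_sqnorm n (phi : R -> \bar R) :
  measurable_fun setT phi -> (forall r, 0 <= phi r) ->
  measurable_fun setT (fun b : R => \int[tau n]_t phi (b + sqnorm t)%R).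
Proof.
move=> mphi phi0.
apply: (@measurable_fun_fubini_tonelli_F _ _ (measurableTypeR R) _ R (tau n)
  (fun x => phi (x.1 + sqnorm x.2)%R)) => //.
apply: (measurableT_comp mphi); apply: measurable_funD => //.
by apply: (measurableT_comp (@measurable_sqnorm n)).
Qed.

(** Each coordinate contributes one factor k. [phi] must stay general in the induction, since fixing
    the first coordinate a replaces it by a shifted function. *)
Lemma ge0_integral_sqnorm_scale n (k : R) (phi : R -> \bar R) : (0 < k)%R ->
  measurable_fun setT phi -> (forall r, 0 <= phi r) ->
  (k ^+ n)%:E * \int[tau n]_t phi (k ^+ 2 * sqnorm t)%R =
  \int[tau n]_t phi (sqnorm t).
Proof.
move=> k0; elim: n phi => [|n IH] phi mphi phi0.
  rewrite expr0 mul1e; apply: eq_integral => t _.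
  by rewrite /sqnorm big_ord0 mulr0.
have mphik : measurable_fun setT (fun r : R => phi (k ^+ 2 * r)%R).
  exact: (measurableT_comp mphi).
rewrite (@ge0_integral_sqnormS _ (fun r => phi (k ^+ 2 * r)%R))//.
rewrite ge0_integral_sqnormS//.
have msq (f : R -> \bar R) (g : R -> R) : measurable_fun setT f ->
    (forall r, 0 <= f r) -> measurable_fun setT g ->
    measurable_fun setT (fun a : R => \int[tau n]_t f (g a + sqnorm t)%R).
  by move=> mf f0 /(measurableT_comp (measurable_integral_sqnorm n mf f0)).
rewrite -[RHS](@ge0_integral_line_scale k
  (fun a => \int[tau n]_t phi (a ^+ 2 + sqnorm t)%R))//; last 2 first.
- exact: msq.
- by move=> u; exact: integral_ge0.
rewrite exprS EFinM -muleA; congr (_ * _).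
rewrite -ge0_integralZl//; last 3 first.
- under eq_fun do under eq_integral do rewrite mulrDr.
  apply: (@measurable_fun_fubini_tonelli_F _ _ (measurableTypeR R) _ R (tau n)
    (fun x => phi (k ^+ 2 * x.1 ^+ 2 + k ^+ 2 * sqnorm x.2)%R)) => //.
  apply: (measurableT_comp mphi); apply: measurable_funD => //.
    by apply: measurable_funM => //; exact: measurable_funX.
  apply: measurable_funM => //.
  by apply: (measurableT_comp (@measurable_sqnorm n)).
- by move=> u _; exact: integral_ge0.
- by rewrite lee_fin exprn_ge0// ltW.
apply: eq_integral => a _.
rewrite -(IH (fun r => phi ((k * a) ^+ 2 + r)%R))//.
- congr (_ * _); apply: eq_integral => t _; congr phi.
  by rewrite mulrDr exprMn.
- apply: (measurableT_comp mphi); exact: measurable_funD.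
Qed.

Lemma integral_expRN_sqnorm n :
  \int[tau n]_t (expR (- sqnorm t))%:E = (pi `^ (n%:R / 2))%:E.
Proof.
have -> : ((pi : R) `^ (n%:R / 2) = Num.sqrt pi ^+ n)%R.
  rewrite -powR12_sqrt ?pi_ge0// -powR_mulrn ?powR_ge0// -powRrM.
  by congr (_ `^ _)%R; rewrite mulrC.
elim: n => [|n IH].
  rewrite expr0 [LHS](_ : _ = \int[tau 0]_t (cst 1%E t)).
    by rewrite integral_cst//= diracT mul1e.
  by apply: eq_integral => t _; rewrite /sqnorm big_ord0 oppr0 expR0.
rewrite (@ge0_integral_sqnormS _ (fun r => (expR (- r))%:E))//; last first.
  by apply/measurable_EFinP; exact: (measurableT_comp (@measurable_expR R)).
transitivity (\int[leb]_a ((gauss_fun a)%:E * (Num.sqrt pi ^+ n)%:E)).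
  apply: eq_integral => a _; rewrite -IH -ge0_integralZl//.
  - by apply: eq_integral => t _; rewrite opprD expRD EFinM.
  - apply/measurable_EFinP; apply: (measurableT_comp (@measurable_expR R)).
    by apply: measurableT_comp => //; exact: measurable_sqnorm.
  - by rewrite lee_fin gauss_fun_ge0.
rewrite ge0_integralZr//.
- by rewrite integralT_gauss -EFinM -exprS.
- by apply/measurable_EFinP; exact: measurable_gauss_fun.
- by move=> a _; rewrite lee_fin gauss_fun_ge0.
Qed.

End tuple_integral.

(** * The volume of the unit ball *)

Section ball_volume.
Local Open Scope ereal_scope.
Context (R : realType) (n : nat).
Local Notation leb := (@lebesgue_measure R).
Local Notation tau := (tuple_measure leb n).
Local Notation S := (@sqnorm R n).
Local Notation B r := (S @^-1` `]-oo, r%R[).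

Lemma measurable_sqnorm_ball (r : R) : measurable (B r).
Proof. by rewrite -[X in measurable X]setTI; exact: measurable_sqnorm. Qed.

Lemma integral_sqnorm_ball (r : R) :
  \int[tau]_t (\1_`]-oo, r[ (S t))%:E = tau (B r).
Proof.
transitivity (\int[tau]_t (\1_(B r) t)%:E); first by [].
by rewrite integral_indic ?setIT//; exact: measurable_sqnorm_ball.
Qed.

(** Dilation by 1/r applied to the indicator of the unit ball. [B] takes the square of the
    radius. *)
Lemma sqnorm_ball_scale (r : R) : (0 < r)%R ->
  tau (B (r ^+ 2)) = (r ^+ n)%:E * tau (B 1).
Proof.
move=> r0; have V0 : (0 < r^-1)%R by rewrite invr_gt0.
have mI : measurable_fun setT (fun x : R => (\1_`]-oo, 1%R[ x : R)%:E).
  by apply/measurable_EFinP; exact: measurable_indic.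
have := @ge0_integral_sqnorm_scale R n _ _ V0 mI (fun x => ltac:(by rewrite lee_fin)).
rewrite integral_sqnorm_ball => h.
rewrite -h muleA -EFinM -exprMn divff ?gt_eqF// expr1n mul1e.
rewrite -integral_sqnorm_ball; apply: eq_integral => t _; congr EFin.
rewrite !indicE; congr ((_ : bool)%:R).
by apply/idP/idP; rewrite !inE/= !in_itv/= exprVn mulrC ltr_pdivrMr ?exprn_gt0// mul1r.
Qed.

Local Notation Ge :=
  (\int[leb]_(t in `]0%R, +oo[) (t `^ (n%:R / 2) * expR (- t))%:E).

(** Since exp (- |x|^2) is the integral of exp (- t) over t > |x|^2, Tonelli on the region |x|^2 < t
    exchanges the order. The slice at t > 0 is the ball of radius sqrt t, of volume t^(n/2) times
    that of the unit ball; the slice at t <= 0 is empty. *)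
Lemma unit_ball_Gamma : tau (B 1) * Ge = (pi `^ (n%:R / 2))%:E.
Proof.
pose F (z : n.-tuple (measurableTypeR R) * measurableTypeR R) : \bar R :=
  (expR (- z.2) * \1_`]0%R, +oo[ (z.2 - S z.1))%:E.
have mF : measurable_fun setT F.
  apply/measurable_EFinP; apply: measurable_funM.
    by apply: (measurableT_comp (@measurable_expR R)); exact: measurableT_comp.
  apply: (measurableT_comp (f := (\1_`]0%R, +oo[ : R -> R))).
    exact: measurable_indic.
  apply: measurable_funB => //.
  by apply: (measurableT_comp (@measurable_sqnorm R n)).
have F0 z : 0 <= F z by rewrite lee_fin mulr_ge0 ?expR_ge0.
have := @fubini_tonelli _ _ _ _ R tau leb F mF F0.
rewrite (_ : \int[tau]_x _ = (pi `^ (n%:R / 2))%:E); last first.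
  rewrite -integral_expRN_sqnorm; apply: eq_integral => x _.
  transitivity (\int[leb]_(t in `]S x, +oo[) (expR (- t))%:E).
    rewrite [RHS]integral_mkcond; apply: eq_integral => t _.
    rewrite patchE /F/= indicE.
    have -> : ((t - S x)%R \in `]0%R, +oo[%classic) = (t \in `]S x, +oo[%classic).
      by apply/idP/idP; rewrite !inE/= !in_itv/= !andbT subr_gt0.
    by case: ifPn => _; rewrite ?mulr1 ?mulr0.
  rewrite integral_itv_obnd_cbnd; last first.
    by apply/measurable_EFinP/measurable_funTS; exact: (measurableT_comp (@measurable_expR R)).
  under eq_integral do rewrite -[X in expR (- X)]mul1r.
  by rewrite integral_expRN// mul1r divr1.
move=> ->.
rewrite -ge0_integralZl//; last 2 first.
- apply: measurable_funTS; apply/measurable_EFinP; apply: measurable_funM => //.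
  exact: (measurableT_comp (@measurable_expR R)).
- by move=> t _; rewrite lee_fin mulr_ge0 ?powR_ge0 ?expR_ge0.
rewrite [LHS]integral_mkcond; apply: eq_integral => t _.
rewrite patchE; case: ifPn.
  rewrite inE/= in_itv/= andbT => t0.
  rewrite /F/=; under eq_integral => x _.
    rewrite (_ : \1_`]0%R, +oo[ (t - S x)%R = \1_`]-oo, t[ (S x) :> R); last first.
      rewrite !indicE; congr ((_ : bool)%:R).
      by apply/idP/idP; rewrite !inE/= !in_itv/= andbT subr_gt0.
    rewrite EFinM; over.
  rewrite ge0_integralZl ?lee_fin ?expR_ge0//; last first.
    apply/measurable_EFinP; apply: (measurableT_comp (f := (\1_`]-oo, t[ : R -> R))).
      exact: measurable_indic.
    exact: measurable_sqnorm.
  have st0 : (0 < Num.sqrt t)%R by rewrite sqrtr_gt0.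
  have := sqnorm_ball_scale st0; rewrite sqr_sqrtr ?ltW// integral_sqnorm_ball => ->.
  rewrite [RHS]muleA -EFinM [RHS]muleC; congr (_ * _%:E).
  rewrite mulrC; congr (_ * _)%R.
  by rewrite -powR12_sqrt ?ltW// -powR_mulrn ?powR_ge0// -powRrM [in RHS]mulrC.
move=> /negP; rewrite inE/= in_itv/= andbT => /negP; rewrite -leNgt => t0.
rewrite integral0_eq// => x _; rewrite /F/= indicE memNset ?mulr0//=.
by rewrite in_itv/= andbT subr_gt0; apply/negP; rewrite -leNgt (le_trans t0)// sqnorm_ge0.
Qed.

Definition unit_ball_volume : R := pi `^ (n%:R / 2) / Gamma (n%:R / 2 + 1).

(** Two nonnegative extended reals whose product is a positive real are both finite and nonzero. So
    [unit_ball_Gamma] alone shows that the Gamma integral converges and can be divided by, and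
    [fine] in [Gamma] loses nothing. *)
Lemma unit_ball_volumeE : tau (B 1) = unit_ball_volume%:E.
Proof.
rewrite /unit_ball_volume; have := unit_ball_Gamma.
have -> : Gamma (n%:R / 2 + 1) = fine Ge.
  by rewrite /Gamma /Rintegral; congr fine; apply: eq_integral => t _; rewrite addrK.
have Ge0 : 0 <= Ge.
  by apply: integral_ge0 => t _; rewrite lee_fin mulr_ge0 ?powR_ge0 ?expR_ge0.
have pin0 : (pi `^ (n%:R / 2) != 0 :> R)%R by rewrite gt_eqF// powR_gt0// pi_gt0.
have : 0 <= tau (B 1) by exact: measure_ge0.
move: Ge Ge0 (tau (B 1)) => [g| |]// g0 [v| |]// v0.
- move=> [vg]; have gn0 : (g != 0)%R.
    by apply: contra_neq pin0 => g00; rewrite -vg g00 mulr0.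
  by rewrite -vg /= mulfK.
- move: g0; rewrite le_eqVlt => /predU1P[<-|g0].
    by rewrite mule0 => -[] /esym/eqP; rewrite (negbTE pin0).
  by rewrite gt0_mulye.
- move: v0; rewrite le_eqVlt => /predU1P[<-|v0].
    by rewrite mul0e => -[] /esym/eqP; rewrite (negbTE pin0).
  by rewrite gt0_muley.
Qed.

End ball_volume.

Lemma unit_ball_volume_gt0 (R : realType) (n : nat) : 0 < unit_ball_volume R n.
Proof.
have := @unit_ball_Gamma R n; rewrite unit_ball_volumeE => VG.
rewrite lt_neqAle -lee_fin -unit_ball_volumeE measure_ge0 andbT.
apply/eqP => V0; move: VG; rewrite -V0 mul0e => -[] /eqP.
by rewrite lt_eqF// powR_gt0// pi_gt0.
Qed.

Section polar_coordinates.
Local Open Scope ereal_scope.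
Context (R : realType) (n : nat).
Local Notation leb := (@lebesgue_measure R).
Local Notation E := (euclidean_space R n).
Local Notation mu := (@lebesgue_measure_nd R n).
Local Notation norm := (@euclidean_norm R n).

Lemma euclidean_norm_ge0 (x : E) : (0 <= norm x)%R.
Proof. exact: sqrtr_ge0. Qed.

Lemma euclidean_measurable (A : set (n.-tuple (measurableTypeR R))) :
  measurable A -> measurable (A : set E).
Proof.
move=> mA; apply: sub_caratheodory; exact: sub_sigma_algebra.
Qed.

Lemma lebesgue_measure_nd_borel (A : set (n.-tuple (measurableTypeR R))) :
  measurable A -> mu A = tuple_measure leb n A.
Proof. exact: measurable_mu_extE. Qed.

Lemma measurable_euclidean_norm : measurable_fun setT norm.
Proof.
move=> _ Y mY; rewrite setTI.
apply: euclidean_measurable.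
rewrite -[X in measurable X]setTI.
have : measurable_fun setT (fun x => Num.sqrt (@sqnorm R n x)).
  apply: (measurableT_comp (f := Num.sqrt : R -> R)).
    exact: (continuous_measurable_fun (@sqrt_continuous R)).
  exact: measurable_sqnorm.
exact.
Qed.

Lemma euclidean_ball_volume (r : R) : (0 < r)%R ->
  mu (norm @^-1` `]-oo, r[) = (unit_ball_volume R n * r ^+ n)%:E.
Proof.
move=> r0.
rewrite (_ : _ @^-1` _ = (@sqnorm R n) @^-1` `]-oo, (r ^+ 2)%R[).
  rewrite lebesgue_measure_nd_borel; last exact: measurable_sqnorm_ball.
  by rewrite sqnorm_ball_scale// unit_ball_volumeE -EFinM mulrC.
have e (x : E) : (norm x < r)%R = (@sqnorm R n x < r ^+ 2)%R.
  by rewrite -[X in (_ < X)%R](ger0_norm (ltW r0)) -sqrtr_sqr ltr_sqrt ?exprn_gt0.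
by apply/seteqP; split => x /=; rewrite !in_itv/= e.
Qed.

End polar_coordinates.

Section polar_coordinatesS.
Local Open Scope ereal_scope.
Context (R : realType) (n : nat).
Local Notation leb := (@lebesgue_measure R).
Local Notation mu := (@lebesgue_measure_nd R n.+1).
Local Notation norm := (@euclidean_norm R n.+1).

(** The factor [unit_ball_volume R n.+1 * n.+1%:R] is the area of the unit sphere. The dimension is
    [n.+1], so the Jacobian has exponent [n]. *)
Lemma integral_polar (phi : R -> \bar R) :
  measurable_fun setT phi -> (forall r, 0 <= phi r) ->
  \int[mu]_x phi (norm x) = \int[leb]_(r in `]0%R, +oo[)
    (phi r * (unit_ball_volume R n.+1 * n.+1%:R * r ^+ n)%:E).
Proof.
move=> mphi phi0; apply: integral_radial => //.
- exact: measurable_euclidean_norm.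
- by move=> x _; exact: euclidean_norm_ge0.
- by move=> r r0; rewrite setTI; exact: euclidean_ball_volume.
Qed.

Lemma euclidean_norm_gt0_ae : {ae mu, forall x, (0 < norm x)%R}.
Proof.
have mN : measurable (norm @^-1` [set 0%R]).
  by rewrite -[X in measurable X]setTI; exact: measurable_euclidean_norm.
exists (norm @^-1` [set 0%R]); split => //.
- transitivity (\int[mu]_x (\1_[set 0%R] (norm x))%:E).
    transitivity (\int[mu]_x (\1_(norm @^-1` [set 0%R]) x)%:E); last by [].
    by rewrite integral_indic ?setIT.
  rewrite (@integral_polar (fun r => (\1_[set 0%R] r)%:E))//; last first.
    by apply/measurable_EFinP; exact: measurable_indic.
  apply: integral0_eq => r /=; rewrite in_itv/= andbT => r0.
  by rewrite indicE memNset ?mul0e//= => r00; rewrite r00 ltxx in r0.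
- move=> x /= /negP; rewrite -leNgt => x0.
  by apply/eqP; rewrite eq_le x0 euclidean_norm_ge0.
Qed.

End polar_coordinatesS.

(** * Schur's test and duality *)

Lemma measurable_fun_powR d (T : measurableType d) (R : realType)
    (D : set T) (h : T -> R) r :
  measurable_fun D h -> measurable_fun D (fun x => h x `^ r).
Proof. by move=> mh; exact: (measurableT_comp (measurable_powR r)). Qed.

Lemma lee_poweR (R : realType) (a b : \bar R) (r : R) :
  0 <= r -> (0%:E <= a -> a <= b -> a `^ r <= b `^ r)%E.
Proof.
move=> r0 a0 ab; apply: gt0_ler_poweR => //; rewrite in_itv/= leey andbT//.
exact: le_trans ab.
Qed.

Section hoelder_nonneg.
Local Open Scope ereal_scope.
Context d (T : measurableType d) (R : realType).
Variable mu : {measure set T -> \bar R}.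
Variables p q : R.
Hypotheses (p0 : (0 < p)%R) (q0 : (0 < q)%R) (pq : (p^-1 + q^-1 = 1)%R).

Let eq_norm (h : T -> R) r : (forall x, 0 <= h x)%R ->
  \int[mu]_x `|(EFin \o h) x| `^ r = \int[mu]_x (h x `^ r)%:E.
Proof.
by move=> h0; apply: eq_integral => x _; rewrite gee0_abs ?lee_fin// poweR_EFin.
Qed.

Lemma hoelder_ge0 (f g : T -> R) :
  measurable_fun setT f -> measurable_fun setT g ->
  (forall x, 0 <= f x)%R -> (forall x, 0 <= g x)%R ->
  \int[mu]_x (f x * g x)%:E <=
  (\int[mu]_x (f x `^ p)%:E) `^ (p^-1) * (\int[mu]_x (g x `^ q)%:E) `^ (q^-1).
Proof.
move=> mf mg f0 g0; have := hoelder mu mf mg p0 q0 pq.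
rewrite Lnorm1 unlock.
under eq_integral do rewrite gee0_abs ?lee_fin ?mulr_ge0//.
by rewrite !eq_norm.
Qed.

Lemma ge0_LfunP (r : R) (r0 : (0 < r)%R) (f : T -> R) :
  (forall x, 0 <= f x)%R ->
  f \in Lfun mu r%:E <->
  measurable_fun setT f /\ \int[mu]_x (f x `^ r)%:E < +oo.
Proof.
move=> f0.
have e : 'N[mu]_(r%:E)[EFin \o f] = (\int[mu]_x (f x `^ r)%:E) `^ (r^-1).
  by rewrite unlock eq_norm.
split.
  move=> fL; have := sub_Lfun_finLfun fL; have := sub_Lfun_mfun fL.
  rewrite !inE/= /finite_norm e => mf lty.
  by split => //; apply: lty_poweRy lty; rewrite invr_neq0 ?gt_eqF.
move=> [mf lty]; apply/andP; split; rewrite inE//=.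
by rewrite /finite_norm e poweR_lty.
Qed.

End hoelder_nonneg.

Section schur.
Local Open Scope ereal_scope.
Context d (T : measurableType d) (R : realType).
Variable mu : {sigma_finite_measure set T -> \bar R}.
Variables p q : R.
Hypotheses (p0 : (0 < p)%R) (q0 : (0 < q)%R) (pq : (p^-1 + q^-1 = 1)%R).

Let pn0 : (p != 0)%R. Proof. by rewrite gt_eqF. Qed.
Let qn0 : (q != 0)%R. Proof. by rewrite gt_eqF. Qed.
Let q_eq : (q = p / (p - 1))%R.
Proof.
have h : (p + q = p * q)%R.
  have -> : (p + q = p * q * (p^-1 + q^-1))%R by field; rewrite pn0 qn0.
  by rewrite pq mulr1.
have p1 : (p - 1 != 0)%R.
  apply/eqP => p1; have e1 : p = 1%R by lra.
  by move: h; rewrite e1; lra.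
by apply: (mulIf p1); rewrite divfK//; lra.
Qed.

Variables (k : T * T -> R) (w : T -> R) (K : R).
Hypotheses (mk : measurable_fun setT k) (k0 : forall z, (0 <= k z)%R).
Hypotheses (mw : measurable_fun setT w) (w0 : forall x, (0 < w x)%R).
Hypothesis K0 : (0 < K)%R.
Hypothesis kw1 : {ae mu, forall y,
  \int[mu]_x (k (x, y) * w x `^ (- q))%:E <= (K * w y `^ (- q))%:E}.
Hypothesis kw2 : {ae mu, forall x,
  \int[mu]_y (k (x, y) * w y `^ (- p))%:E <= (K * w x `^ (- p))%:E}.

Let mkx y : measurable_fun setT (fun x => k (x, y)).
Proof. by apply: (measurableT_comp mk); exact: measurable_pair2. Qed.

Let mky x : measurable_fun setT (fun y => k (x, y)).
Proof. by apply: (measurableT_comp mk); exact: measurable_pair1. Qed.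

(** Hoelder for the splitting f k = (f w k^(1/p)) (k^(1/q) w^(-1)). The hypothesis bounds the q-th
    power of the second factor, and (K w^(-q))^(p/q) = K^(p-1) w^(-p) because p/q = p - 1. *)
Lemma schur_pointwise (f : T -> R) y :
  measurable_fun setT f -> (forall x, 0 <= f x)%R ->
  \int[mu]_x (k (x, y) * w x `^ (- q))%:E <= (K * w y `^ (- q))%:E ->
  (\int[mu]_x (f x * k (x, y))%:E) `^ p <=
  (K `^ (p - 1) * w y `^ (- p))%:E *
    \int[mu]_x (f x `^ p * w x `^ p * k (x, y))%:E.
Proof.
move=> mf f0 hy.
pose F x := (f x * w x * k (x, y) `^ p^-1)%R.
pose G x := (k (x, y) `^ q^-1 * w x `^ (-1))%R.
have F0 x : (0 <= F x)%R by rewrite !mulr_ge0 ?powR_ge0// ltW.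
have G0 x : (0 <= G x)%R by rewrite !mulr_ge0 ?powR_ge0.
have mF : measurable_fun setT F.
  by apply: measurable_funM; [exact: measurable_funM|exact: measurable_fun_powR].
have mG : measurable_fun setT G.
  by apply: measurable_funM; exact: measurable_fun_powR.
have FG x : (F x * G x = f x * k (x, y))%R.
  rewrite /F /G powR_inv1 ?(ltW (w0 x))//.
  transitivity (f x * (k (x, y) `^ p^-1 * k (x, y) `^ q^-1) * (w x / w x))%R.
    by ring.
  rewrite divff ?gt_eqF// mulr1 -powRD ?pq ?oner_eq0//= powRr1//.
have Fp x : (F x `^ p = f x `^ p * w x `^ p * k (x, y))%R.
  rewrite !powRM ?mulr_ge0 ?powR_ge0 ?(ltW (w0 x))// -powRrM mulVf//.
  by rewrite powRr1.
have Gq x : (G x `^ q = k (x, y) * w x `^ (- q))%R.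
  rewrite !powRM ?powR_ge0// -!powRrM mulVf// mulN1r.
  by rewrite powRr1.
have EF : \int[mu]_x (F x `^ p)%:E =
    \int[mu]_x (f x `^ p * w x `^ p * k (x, y))%:E.
  by apply: eq_integral => x _; rewrite Fp.
have EG : \int[mu]_x (G x `^ q)%:E = \int[mu]_x (k (x, y) * w x `^ (- q))%:E.
  by apply: eq_integral => x _; rewrite Gq.
have EFG : \int[mu]_x (F x * G x)%:E = \int[mu]_x (f x * k (x, y))%:E.
  by apply: eq_integral => x _; rewrite FG.
have := @hoelder_ge0 _ _ _ mu _ _ p0 q0 pq _ _ mF mG F0 G0.
rewrite [X in X <= _]EFG [X in _ <= X `^ _ * _]EF [X in _ * X `^ _]EG => h.
apply: (@le_trans _ _ (((\int[mu]_x (f x `^ p * w x `^ p * k (x, y))%:E) `^ p^-1 *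
  (K * w y `^ (- q))%:E `^ q^-1) `^ p)).
  apply: lee_poweR; first exact: ltW.
    by apply: integral_ge0 => x _; rewrite lee_fin mulr_ge0.
  apply: (le_trans h); rewrite lee_wpmul2l ?poweR_ge0//.
  apply: lee_poweR => //; first by rewrite invr_ge0 ltW.
  by apply: integral_ge0 => x _; rewrite lee_fin mulr_ge0// powR_ge0.
rewrite poweRM ?poweR_ge0// -!poweRrM mulVf// poweRe1; last first.
  by apply: integral_ge0 => x _; rewrite lee_fin !mulr_ge0// powR_ge0.
rewrite muleC poweR_EFin powRM ?powR_ge0 ?(ltW K0)// -powRrM.
have -> : (q^-1 * p = p - 1)%R.
  have -> : (q^-1 = 1 - p^-1)%R by rewrite -pq addrAC subrr add0r.
  by rewrite mulrBl mul1r mulVf.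
have -> // : (- q * (p - 1) = - p)%R.
rewrite q_eq mulNr divfK//.
apply/eqP => p1; have e1 : p = 1%R by lra.
by move: q0; rewrite q_eq e1 subrr invr0 mulr0 ltxx.
Qed.

(** Integrate [schur_pointwise] in y and exchange the order. The second weight condition then yields
    another factor K and w(x)^(-p), which cancels the w(x)^p put in by Hoelder. *)
Lemma schur (f : T -> R) : measurable_fun setT f -> (forall x, 0 <= f x)%R ->
  \int[mu]_y ((\int[mu]_x (f x * k (x, y))%:E) `^ p) <=
  (K `^ p)%:E * \int[mu]_x (f x `^ p)%:E.
Proof.
move=> mf f0.
pose H (z : T * T) := (f z.1 `^ p * w z.1 `^ p * k z * w z.2 `^ (- p))%R.
have mH : measurable_fun setT H.
  apply: measurable_funM; last by apply: measurable_fun_powR; exact: (measurableT_comp mw).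
  apply: measurable_funM => //; apply: measurable_funM; apply: measurable_fun_powR.
    exact: (measurableT_comp mf).
  exact: (measurableT_comp mw).
have H0 z : (0 <= H z)%R by rewrite !mulr_ge0// powR_ge0.
have mEH : measurable_fun setT (EFin \o H) by exact/measurable_EFinP.
have Kp0 : (0 <= K `^ (p - 1))%R by exact: powR_ge0.
apply: (@le_trans _ _ (\int[mu]_y ((K `^ (p - 1))%:E * \int[mu]_x (H (x, y))%:E))).
  apply: ae_ge0_le_integral => //.
  - by move=> y _; exact: poweR_ge0.
  - apply: (measurableT_comp (measurable_poweR p)).
    apply: (@measurable_fun_fubini_tonelli_G _ _ T T R mu (fun z => (f z.1 * k z)%:E)) => //.
      apply/measurable_EFinP/measurable_funM => //; exact: (measurableT_comp mf).
    by move=> z; rewrite lee_fin mulr_ge0.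
  - move=> y _; rewrite mule_ge0 ?lee_fin// integral_ge0// => x _.
    by rewrite lee_fin.
  - apply: emeasurable_funM => //.
    by apply: (@measurable_fun_fubini_tonelli_G _ _ T T R mu (EFin \o H)).
  - apply: filterS kw1 => y hy _.
    apply: (le_trans (schur_pointwise mf f0 hy)).
    rewrite EFinM -muleA lee_wpmul2l ?lee_fin// -ge0_integralZl//.
    + rewrite le_eqVlt; apply/orP; left; apply/eqP; apply: eq_integral => x _.
      by rewrite -EFinM /H/= mulrC.
    + apply/measurable_EFinP/measurable_funM => //.
      by apply: measurable_funM; exact: measurable_fun_powR.
    + by move=> x _; rewrite lee_fin !mulr_ge0// powR_ge0.
    + by rewrite lee_fin powR_ge0.
rewrite ge0_integralZl//; last 2 first.
- by apply: (@measurable_fun_fubini_tonelli_G _ _ T T R mu (EFin \o H)).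
- by move=> y _; apply: integral_ge0 => x _; rewrite lee_fin.
rewrite -(@fubini_tonelli _ _ _ _ R mu mu (EFin \o H))//.
have -> : (K `^ p = K `^ (p - 1) * K)%R.
  by rewrite mulrC mulr_powRB1// ltW.
rewrite EFinM -muleA lee_wpmul2l ?lee_fin// -ge0_integralZl//; last 3 first.
- by apply/measurable_EFinP; exact: measurable_fun_powR.
- by move=> x _; rewrite lee_fin powR_ge0.
- by rewrite lee_fin ltW.
apply: ae_ge0_le_integral => //.
- by move=> x _; apply: integral_ge0 => y _; rewrite lee_fin.
- by apply: (@measurable_fun_fubini_tonelli_F _ _ T T R mu (EFin \o H)).
- by move=> x _; rewrite mule_ge0 ?lee_fin ?powR_ge0// ltW.
- by apply: emeasurable_funM => //; apply/measurable_EFinP; exact: measurable_fun_powR.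
- apply: filterS kw2 => x hx _ /=.
  have -> : \int[mu]_y (H (x, y))%:E = (f x `^ p * w x `^ p)%:E *
      \int[mu]_y (k (x, y) * w y `^ (- p))%:E.
    rewrite -ge0_integralZl//.
    + by apply: eq_integral => y _; rewrite -EFinM /H/= mulrA.
    + apply/measurable_EFinP/measurable_funM => //; exact: measurable_fun_powR.
    + by move=> y _; rewrite lee_fin mulr_ge0// powR_ge0.
    + by rewrite lee_fin mulr_ge0 ?powR_ge0.
  apply: (@le_trans _ _ ((f x `^ p * w x `^ p)%:E * (K * w x `^ (- p))%:E)).
    by rewrite lee_wpmul2l// lee_fin mulr_ge0 ?powR_ge0.
  rewrite -!EFinM lee_fin powRN.
  rewrite mulrACA mulrC -mulrA [X in (_ * (_ * X) <= _)%R]mulrC.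
  by rewrite le_eqVlt; apply/orP; left; apply/eqP; field; rewrite gt_eqF// powR_gt0.
Qed.

End schur.

Section duality.
Local Open Scope ereal_scope.
Context d (T : measurableType d) (R : realType).
Variable mu : {measure set T -> \bar R}.
Variables p q : R.
Hypotheses (p0 : (0 < p)%R) (q0 : (0 < q)%R) (pq : (p^-1 + q^-1 = 1)%R).
Variable G : T -> \bar R.
Hypotheses (mG : measurable_fun setT G) (G0 : forall x, 0 <= G x).
Hypothesis Gp : \int[mu]_x (G x `^ p) < +oo.

Let mGp : measurable_fun setT (fun x => G x `^ p).
Proof. exact: (measurableT_comp (measurable_poweR p)). Qed.

Let mfG : measurable_fun setT (fun x => fine (G x)).
Proof. exact: (measurableT_comp (@fine_measurable R setT measurableT)). Qed.

Let fG0 x : (0 <= fine (G x))%R.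
Proof. exact: fine_ge0. Qed.

(** An integrable p-th power is finite almost everywhere, so Hoelder's inequality for real functions
    extends to the extended-valued [G]. *)
Let G_fin : {ae mu, forall x, G x = (fine (G x))%:E}.
Proof.
have : mu.-integrable setT (fun x => G x `^ p).
  apply/integrableP; split => //.
  rewrite (eq_integral (fun x => G x `^ p))// => x _.
  by rewrite gee0_abs ?poweR_ge0.
move/(integrable_ae measurableT); apply: filterS => x /(_ I).
rewrite ge0_fin_numE ?poweR_ge0// => /lty_poweRy Gx.
by rewrite fineK// ge0_fin_numE// Gx// gt_eqF.
Qed.

Let integral_fine_powR : \int[mu]_x (fine (G x) `^ p)%:E = \int[mu]_x (G x `^ p).
Proof.
apply: ge0_ae_eq_integral => //.
- by apply/measurable_EFinP; exact: measurable_fun_powR.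
- by move=> x _; rewrite lee_fin powR_ge0.
- by move=> x _; rewrite poweR_ge0.
- by apply: filterS G_fin => x /= Gx _; rewrite [in RHS]Gx poweR_EFin.
Qed.

Let integral_fine_mul (g : T -> R) : measurable_fun setT g ->
  (forall x, 0 <= g x)%R ->
  \int[mu]_x (fine (G x) * g x)%:E = \int[mu]_x (G x * (g x)%:E).
Proof.
move=> mg g0; apply: ge0_ae_eq_integral => //.
- by apply/measurable_EFinP; exact: measurable_funM.
- by apply: emeasurable_funM => //; exact/measurable_EFinP.
- by move=> x _; rewrite lee_fin mulr_ge0.
- by move=> x _; rewrite mule_ge0 ?lee_fin.
- by apply: filterS G_fin => x /= Gx _; rewrite [in RHS]Gx EFinM.
Qed.

Lemma ge0_hoelder_ereal (g : T -> R) : measurable_fun setT g ->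
  (forall x, 0 <= g x)%R ->
  \int[mu]_x (G x * (g x)%:E) <=
  (\int[mu]_x (G x `^ p)) `^ (p^-1) * (\int[mu]_x (g x `^ q)%:E) `^ (q^-1).
Proof.
move=> mg g0; rewrite -[X in X <= _]integral_fine_mul// -[X in _ <= X `^ _ * _]integral_fine_powR.
exact: hoelder_ge0.
Qed.

Lemma hoelder_conj_powR (a : R) : ((a `^ (p - 1)) `^ q = a `^ p)%R.
Proof.
rewrite -powRrM; congr (_ `^ _)%R.
have h : (p + q = p * q)%R.
  have -> : (p + q = p * q * (p^-1 + q^-1))%R by field; rewrite !gt_eqF.
  by rewrite pq mulr1.
by rewrite mulrBl mul1r -h addrK.
Qed.

(** Test on g = G^(p-1): both g^q and G g equal G^p almost everywhere. With a the integral of G^p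
    this reads a <= M a^(1/q), and dividing by a^(1/q) uses that a is finite. *)
Lemma Lp_dual_le (M : R) : (0 <= M)%R ->
  (forall g : T -> R, measurable_fun setT g -> (forall x, 0 <= g x)%R ->
     \int[mu]_x (g x `^ q)%:E < +oo ->
     \int[mu]_x (G x * (g x)%:E) <= M%:E * (\int[mu]_x (g x `^ q)%:E) `^ (q^-1)) ->
  (\int[mu]_x (G x `^ p)) `^ (p^-1) <= M%:E.
Proof.
move=> M0 dual.
pose g x := (fine (G x) `^ (p - 1))%R.
have mg : measurable_fun setT g by exact: measurable_fun_powR.
have g0 x : (0 <= g x)%R by exact: powR_ge0.
have gq : \int[mu]_x (g x `^ q)%:E = \int[mu]_x (G x `^ p).
  rewrite -[RHS]integral_fine_powR; apply: eq_integral => x _.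
  by rewrite hoelder_conj_powR.
have gG : \int[mu]_x (G x * (g x)%:E) = \int[mu]_x (G x `^ p).
  rewrite -[LHS]integral_fine_mul// -[RHS]integral_fine_powR.
  apply: eq_integral => x _.
  by rewrite mulr_powRB1.
have := dual g mg g0.
rewrite [X in X < _]gq [X in X <= _]gG [X in _ * X `^ _]gq => /(_ Gp).
have : 0 <= \int[mu]_x (G x `^ p) by apply: integral_ge0 => x _; exact: poweR_ge0.
move: (\int[mu]_x _) Gp => [a| |]// _; rewrite lee_fin => a0.
rewrite !poweR_EFin -EFinM !lee_fin => h.
move: a0; rewrite le_eqVlt => /predU1P[<-|a0].
  by rewrite powR0// invr_neq0 ?gt_eqF.
rewrite -(ler_pM2r (powR_gt0 q^-1 a0)); apply: le_trans h.
rewrite -powRD; first by rewrite pq powRr1 // ltW.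
by rewrite pq oner_eq0.
Qed.

End duality.

(** * Hilbert-type inequalities for radial kernels *)

Section hilbert_forms.
Local Open Scope ereal_scope.
Context d (T : measurableType d) (R : realType).
Variable mu : {sigma_finite_measure set T -> \bar R}.
Variable norm : T -> R.
Hypotheses (mnorm : measurable_fun setT norm) (norm_ge0 : forall x, (0 <= norm x)%R).
Variable N : R.
Implicit Types (p q C : R) (f g : T -> R).

(** Both power weights are absorbed. The factor in z.2, raised to the power p, is the outer weight
    |y|^(1-N) of (b), so (b) becomes a plain L^p bound for [transform]; and exchanging p and q
    transposes the kernel. *)
Definition kernel p q (z : T * T) : R :=
  (norm z.1 `^ ((1 - N) * (1 / q)) / (norm z.1 + norm z.2)
   * norm z.2 `^ ((1 - N) * (1 / p)))%R.

Definition bilinear_bound p q C f g : Prop :=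
  \int[mu]_y \int[mu]_x
    (f x * g y / (norm x + norm y)
       * norm x `^ ((1 - N) * (1 / q)) * norm y `^ ((1 - N) * (1 / p)))%:E
  <= C%:E * (\int[mu]_x (f x `^ p)%:E) `^ (1 / p)
          * (\int[mu]_y (g y `^ q)%:E) `^ (1 / q).

Definition operator_bound p q C f : Prop :=
  (\int[mu]_y
     ((\int[mu]_x (f x / (norm x + norm y) * norm x `^ ((1 - N) * (1 / q)))%:E) `^ p
        * (norm y `^ (1 - N))%:E)) `^ (1 / p)
  <= C%:E * (\int[mu]_x (f x `^ p)%:E) `^ (1 / p).

Definition transform p q f (y : T) : \bar R :=
  \int[mu]_x (f x * kernel p q (x, y))%:E.

Lemma kernel_ge0 p q z : (0 <= kernel p q z)%R.
Proof. by rewrite !mulr_ge0 ?powR_ge0// invr_ge0 addr_ge0. Qed.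

Let mnorm1 : measurable_fun setT (fun z : T * T => norm z.1).
Proof. exact: (measurableT_comp mnorm). Qed.

Let mnorm2 : measurable_fun setT (fun z : T * T => norm z.2).
Proof. exact: (measurableT_comp mnorm). Qed.

Lemma measurable_kernel p q : measurable_fun setT (kernel p q).
Proof.
apply: measurable_funM; last exact: measurable_fun_powR.
apply: measurable_funM; first exact: measurable_fun_powR.
by apply: measurable_funV; exact: measurable_funD.
Qed.

Section conjugate.
Variables p q : R.
Hypotheses (p0 : (0 < p)%R) (q0 : (0 < q)%R) (pq : (p^-1 + q^-1 = 1)%R).
Local Notation k := (kernel p q).
Local Notation H := (transform p q).

Let pn0 : (p != 0)%R. Proof. by rewrite gt_eqF. Qed.

Let mfk f : measurable_fun setT f ->
  measurable_fun setT (fun z : T * T => (f z.1 * k z)%:E).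
Proof.
move=> mf; apply/measurable_EFinP; apply: measurable_funM.
  exact: (measurableT_comp mf).
exact: measurable_kernel.
Qed.

Let mkx y : measurable_fun setT (fun x : T => k (x, y)).
Proof.
apply: (measurableT_comp (measurable_kernel p q)).
exact: measurable_pair2.
Qed.

Lemma transform_ge0 f y : (forall x, 0 <= f x)%R -> 0 <= H f y.
Proof.
move=> f0; apply: integral_ge0 => x _.
by rewrite lee_fin mulr_ge0// kernel_ge0.
Qed.

Lemma measurable_transform f : measurable_fun setT f ->
  (forall x, 0 <= f x)%R -> measurable_fun setT (H f).
Proof.
move=> mf f0.
apply: (@measurable_fun_fubini_tonelli_G _ _ T T R mu
  (fun z => (f z.1 * k z)%:E)); first exact: mfk.
by move=> z; rewrite lee_fin mulr_ge0// kernel_ge0.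
Qed.

Lemma operator_boundE f C : measurable_fun setT f -> (forall x, 0 <= f x)%R ->
  operator_bound p q C f <->
  (\int[mu]_y (H f y `^ p)) `^ (p^-1) <=
  C%:E * (\int[mu]_x (f x `^ p)%:E) `^ (p^-1).
Proof.
move=> mf f0; rewrite /operator_bound !div1r.
rewrite [X in X `^ _ <= _ <-> _](_ : _ = \int[mu]_y (H f y `^ p))//.
apply: eq_integral => y _.
have -> : H f y = (\int[mu]_x (f x / (norm x + norm y)
    * norm x `^ ((1 - N) * q^-1))%:E) * (norm y `^ ((1 - N) * p^-1))%:E.
  rewrite -ge0_integralZr//.
  - apply: eq_integral => x _; rewrite -EFinM /kernel/= !div1r.
    by congr EFin; ring.
  - apply/measurable_EFinP; apply: measurable_funM.
      apply: measurable_funM => //; apply: measurable_funV.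
      by apply: measurable_funD => //; exact: mnorm.
    by apply: measurable_fun_powR; exact: mnorm.
  - move=> x _; rewrite lee_fin mulr_ge0 ?powR_ge0// divr_ge0//.
    by rewrite addr_ge0 ?norm_ge0.
  - by rewrite lee_fin powR_ge0.
rewrite poweRM ?lee_fin ?powR_ge0//; last first.
  apply: integral_ge0 => x _; rewrite lee_fin mulr_ge0 ?powR_ge0// divr_ge0//.
  by rewrite addr_ge0 ?norm_ge0.
by rewrite poweR_EFin -powRrM -mulrA mulVf// mulr1.
Qed.

Lemma bilinear_boundE f g C : measurable_fun setT f -> (forall x, 0 <= f x)%R ->
  (forall x, 0 <= g x)%R ->
  bilinear_bound p q C f g <->
  \int[mu]_y (H f y * (g y)%:E) <= C%:E * (\int[mu]_x (f x `^ p)%:E) `^ (p^-1)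
     * (\int[mu]_x (g x `^ q)%:E) `^ (q^-1).
Proof.
move=> mf f0 g0; rewrite /bilinear_bound !div1r.
rewrite [X in X <= _ <-> _](_ : _ = \int[mu]_y (H f y * (g y)%:E))//.
apply: eq_integral => y _.
rewrite -ge0_integralZr//.
- apply: eq_integral => x _; rewrite -EFinM /kernel/= !div1r.
  by congr EFin; ring.
- by apply/measurable_EFinP; exact: measurable_funM.
- by move=> x _; rewrite lee_fin mulr_ge0// kernel_ge0.
- by rewrite lee_fin.
Qed.

(** Tonelli and the symmetry of |x| + |y|. Through this, every statement on (c) is one on (b) for
    the exchanged exponents. *)
Lemma bilinear_boundC f g C : measurable_fun setT f -> measurable_fun setT g ->
  (forall x, 0 <= f x)%R -> (forall x, 0 <= g x)%R ->
  bilinear_bound p q C f g <-> bilinear_bound q p C g f.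
Proof.
move=> mf mg f0 g0; rewrite /bilinear_bound.
rewrite [X in _ <-> _ <= X]muleAC.
pose F (z : T * T) : \bar R := (g z.1 * f z.2 / (norm z.1 + norm z.2) *
  norm z.1 `^ ((1 - N) * (1 / p)) * norm z.2 `^ ((1 - N) * (1 / q)))%:E.
have mF : measurable_fun setT F.
  apply/measurable_EFinP; apply: measurable_funM; last exact: measurable_fun_powR.
  apply: measurable_funM; last exact: measurable_fun_powR.
  apply: measurable_funM; last by apply: measurable_funV; exact: measurable_funD.
  by apply: measurable_funM; [exact: (measurableT_comp mg)|exact: (measurableT_comp mf)].
have F0 z : 0 <= F z.
  rewrite lee_fin !mulr_ge0 ?powR_ge0// invr_ge0.
  by rewrite addr_ge0 ?norm_ge0.
have E1 : \int[mu]_y \int[mu]_x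
    (f x * g y / (norm x + norm y)
       * norm x `^ ((1 - N) * (1 / q)) * norm y `^ ((1 - N) * (1 / p)))%:E =
    \int[mu]_y \int[mu]_x F (y, x).
  apply: eq_integral => y _; apply: eq_integral => x _; congr EFin => /=.
  by rewrite [(norm x + _)%R]addrC; ring.
have E2 := fubini_tonelli F mF F0.
rewrite [X in X <= _ <-> _]E1 [X in X <= _ <-> _]E2.
exact: iff_refl.
Qed.

Variable K : R.
Hypothesis K0 : (0 < K)%R.
Hypothesis KH : forall f, measurable_fun setT f -> (forall x, 0 <= f x)%R ->
  \int[mu]_y (H f y `^ p) <= (K `^ p)%:E * \int[mu]_x (f x `^ p)%:E.

(** The a priori finiteness behind both directions of the equivalence, where the constant C is
    unrelated to [K]. *)
Lemma transform_lty f : measurable_fun setT f -> (forall x, 0 <= f x)%R ->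
  \int[mu]_x (f x `^ p)%:E < +oo -> \int[mu]_y (H f y `^ p) < +oo.
Proof.
move=> mf f0 fp; apply: (le_lt_trans (KH mf f0)).
by rewrite lte_mul_pinfty ?lee_fin ?powR_ge0.
Qed.

Lemma operator_bound_constant f : measurable_fun setT f -> (forall x, 0 <= f x)%R ->
  operator_bound p q K f.
Proof.
move=> mf f0; apply/operator_boundE => //.
have -> : K%:E = (K `^ p)%:E `^ p^-1.
  by rewrite poweR_EFin -powRrM divff// powRr1// ltW.
have If : 0 <= \int[mu]_x (f x `^ p)%:E.
  by apply: integral_ge0 => x _; rewrite lee_fin powR_ge0.
rewrite -poweRM ?lee_fin ?powR_ge0//.
apply: lee_poweR; first by rewrite invr_ge0 ltW.
- by apply: integral_ge0 => y _; exact: poweR_ge0.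
- exact: KH.
Qed.

Lemma operator_bilinear_bound f g C : measurable_fun setT f -> (forall x, 0 <= f x)%R ->
  \int[mu]_x (f x `^ p)%:E < +oo ->
  measurable_fun setT g -> (forall x, 0 <= g x)%R ->
  operator_bound p q C f -> bilinear_bound p q C f g.
Proof.
move=> mf f0 fp mg g0 /(operator_boundE _ mf f0) hb; apply/bilinear_boundE => //.
have := @ge0_hoelder_ereal _ _ _ mu p q p0 q0 pq (H f)
  (measurable_transform mf f0) (fun y => transform_ge0 y f0)
  (transform_lty mf f0 fp) g mg g0.
by move=> /le_trans; apply; rewrite lee_wpmul2r// poweR_ge0.
Qed.

Lemma bilinear_operator_bound f C : measurable_fun setT f -> (forall x, 0 <= f x)%R ->
  \int[mu]_x (f x `^ p)%:E < +oo ->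
  (forall g, measurable_fun setT g -> (forall x, 0 <= g x)%R ->
     \int[mu]_x (g x `^ q)%:E < +oo -> bilinear_bound p q C f g) ->
  operator_bound p q C f.
Proof.
move=> mf f0 fp ha; apply/operator_boundE => //.
(* C may be negative, whereas duality asks for C times the norm of f to be nonnegative. Testing the
   bilinear bound on g = f^(p-1), which lies in L^q, gives this sign. *)
have mfp : measurable_fun setT (fun x => f x `^ (p - 1))%R.
  exact: measurable_fun_powR.
have fp0 x : (0 <= f x `^ (p - 1))%R by exact: powR_ge0.
have fpq : \int[mu]_x ((f x `^ (p - 1)) `^ q)%:E = \int[mu]_x (f x `^ p)%:E.
  by apply: eq_integral => x _; rewrite (hoelder_conj_powR p0 q0 pq).
have If : 0 <= \int[mu]_x (f x `^ p)%:E.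
  by apply: integral_ge0 => x _; rewrite lee_fin powR_ge0.
have IH g : (forall x, 0 <= g x)%R -> 0 <= \int[mu]_y (H f y * (g y)%:E).
  move=> g0; apply: integral_ge0 => y _.
  by rewrite mule_ge0 ?lee_fin// transform_ge0.
have := ha _ mfp fp0; rewrite [X in X < _]fpq => /(_ fp) /(bilinear_boundE _ mf f0 fp0).
rewrite [X in _ * X `^ _]fpq => /(le_trans (IH _ fp0)).
have haE g (mg : measurable_fun setT g) (g0 : forall x, (0 <= g x)%R) gq :=
  (bilinear_boundE C mf f0 g0).1 (ha g mg g0 gq).
have H_lty := transform_lty mf f0 fp.
move: (\int[mu]_x (f x `^ p)%:E) fp If haE => [a| |]// _; rewrite lee_fin => a0 haE.
rewrite !poweR_EFin -!EFinM lee_fin => C0.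
apply: (@Lp_dual_le _ _ _ mu p q p0 q0 pq (H f) (measurable_transform mf f0)
  (fun y => transform_ge0 y f0) H_lty).
- move: a0; rewrite le_eqVlt => /predU1P[<-|a0].
    by rewrite powR0 ?mulr0// invr_neq0.
  by rewrite -(pmulr_lge0 _ (powR_gt0 q^-1 a0)).
- by move=> g mg g0 gq; have := haE g mg g0 gq; rewrite poweR_EFin -EFinM.
Qed.

End conjugate.

End hilbert_forms.

Lemma gt0_powR_expR (R : realType) (r a : R) : 0 < r -> r `^ a = expR (a * ln r).
Proof. by move=> r0; rewrite /powR gt_eqF. Qed.

Section radial_schur.
Local Open Scope ereal_scope.
Context d (T : measurableType d) (R : realType).
Local Notation leb := (@lebesgue_measure R).
Variable mu : {sigma_finite_measure set T -> \bar R}.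
Variable norm : T -> R.
Hypotheses (mnorm : measurable_fun setT norm) (norm_ge0 : forall x, (0 <= norm x)%R).
Hypothesis norm_gt0 : {ae mu, forall x, (0 < norm x)%R}.
Variables (n : nat) (omega : R).
Hypothesis omega0 : (0 < omega)%R.
Hypothesis polar : forall phi : R -> \bar R,
  measurable_fun setT phi -> (forall r, 0 <= phi r) ->
  \int[mu]_x phi (norm x) =
  \int[leb]_(r in `]0%R, +oo[) (phi r * (omega * r ^+ n)%:E).
Local Notation N := (n.+1%:R : R).

(* This is norm x `^ (N / (p * q)) off the origin, but it never vanishes. *)
Definition radial_weight (p q : R) (x : T) : R :=
  expR (N / (p * q) * ln (norm x)).

Lemma radial_weight_gt0 p q x : (0 < radial_weight p q x)%R.
Proof. exact: expR_gt0. Qed.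

Lemma measurable_radial_weight p q : measurable_fun setT (radial_weight p q).
Proof.
apply: (measurableT_comp (@measurable_expR R)); apply: measurable_funM => //.
by apply: (measurableT_comp (@measurable_ln R)).
Qed.

Lemma radial_weightC p q : radial_weight q p = radial_weight p q.
Proof. by apply/funext => x; rewrite /radial_weight [(q * p)%R]mulrC. Qed.

Lemma kernelC p q (x y : T) : kernel norm N q p (x, y) = kernel norm N p q (y, x).
Proof. by rewrite /kernel/= [(norm x + _)%R]addrC; ring. Qed.

(** pi/q = pi - pi/p; hence the constant is the same for (b) and (c). *)
Lemma sin_conjugate p q : (p^-1 + q^-1 = 1)%R -> sin (pi / q) = sin (pi / p) :> R.
Proof.
move=> pq; have -> : (pi / q = - (pi / p) + pi)%R.
  have -> : (q^-1 = 1 - p^-1)%R by rewrite -pq addrAC subrr add0r.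
  by ring.
by rewrite sinDpi sinN opprK.
Qed.

Section conjugate.
Variables p q : R.
Hypotheses (p0 : (0 < p)%R) (q0 : (0 < q)%R) (pq : (p^-1 + q^-1 = 1)%R).
Local Notation k := (kernel norm N p q).
Local Notation w := (radial_weight p q).
Local Notation K := (omega * (pi / sin (pi / p)))%R.

Let pn0 : (p != 0)%R. Proof. by rewrite gt_eqF. Qed.
Let qn0 : (q != 0)%R. Proof. by rewrite gt_eqF. Qed.
Let qV : (q^-1 = 1 - p^-1)%R. Proof. by rewrite -pq addrAC subrr add0r. Qed.
Let pV01 : (0 < p^-1 < 1)%R.
Proof.
rewrite invr_gt0 p0/=; have : (0 < q^-1)%R by rewrite invr_gt0.
by rewrite qV subr_gt0.
Qed.

Lemma radial_constant_gt0 : (0 < K)%R.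
Proof.
have s0 : (0 < sin (pi / p))%R.
  rewrite sin_gt0_pi// divr_gt0 ?pi_gt0//=.
  by have /andP[_ p1] := pV01; rewrite gtr_pMr ?pi_gt0.
by rewrite mulr_gt0// divr_gt0// pi_gt0.
Qed.

(* The weight is chosen so that all powers of the radius combine to -1/p. *)
Lemma integral_radial_weight (s : R) : (0 < s)%R ->
  \int[mu]_x (norm x `^ ((1 - N) * (1 / q)) / (norm x + s) * w x `^ (- q))%:E =
  (K * s `^ (- p^-1))%:E.
Proof.
move=> s0.
(* The absolute value makes the profile nonnegative on the whole line, as [polar] demands. *)
pose phi (r : R) : \bar R := (r `^ ((1 - N) * (1 / q)) / (`|r| + s)
  * expR (N / (p * q) * ln r) `^ (- q))%:E.
transitivity (\int[mu]_x phi (norm x)).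
  by apply: eq_integral => x _; rewrite /phi ger0_norm ?norm_ge0.
rewrite polar; last 2 first.
- apply/measurable_EFinP; apply: measurable_funM.
    apply: measurable_funM => //; apply: measurable_funV.
    by apply: measurable_funD.
  apply: measurable_fun_powR; apply: (measurableT_comp (@measurable_expR R)).
  exact: measurable_funM.
- move=> r; rewrite lee_fin mulr_ge0 ?powR_ge0// divr_ge0 ?powR_ge0//.
  by rewrite addr_ge0// ltW.
transitivity (\int[leb]_(r in `]0%R, +oo[)
  ((omega)%:E * (r `^ (- p^-1) / (r + s))%:E)).
  apply: eq_integral => r /[!inE]/=; rewrite in_itv/= andbT => r0.
  rewrite -!EFinM; congr EFin; rewrite gtr0_norm//.
  rewrite -powR_mulrn ?(ltW r0)// -expRM !gt0_powR_expR//.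
  rewrite [RHS](_ : _ = (omega / (r + s)
    * expR (- p^-1 * ln r))%R); last by ring.
  (* Kernel, weight and Jacobian contribute (1-N)/q, -N/p and N-1, whose sum is -1/p. *)
  have -> : (- p^-1 * ln r = (1 - N) * (1 / q) * ln r
      + N / (p * q) * ln r * - q + n%:R * ln r)%R.
    have -> : (1 / q = 1 - p^-1)%R by rewrite div1r.
    have -> : (N = n%:R + 1)%R by rewrite -natr1.
    by field; rewrite pn0 qn0.
  by rewrite !expRD; ring.
rewrite ge0_integralZl//; last 3 first.
- by apply: measurable_funTS; apply/measurable_EFinP; exact: measurable_powR_kernel.
- move=> r /=; rewrite in_itv/= andbT => r0.
  by rewrite lee_fin divr_ge0 ?powR_ge0// addr_ge0 ?ltW.
- by rewrite lee_fin ltW.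
rewrite integral_powR_kernel// -EFinM; congr EFin.
by ring.
Qed.

(** This is in fact an equality: the remaining exponents (1-N)/p and -1/p add up to -N/p, the
    exponent of w^(-q). *)
Lemma radial_weight_le (y : T) : (0 < norm y)%R ->
  \int[mu]_x (k (x, y) * w x `^ (- q))%:E <= (K * w y `^ (- q))%:E.
Proof.
move=> y0.
have -> : \int[mu]_x (k (x, y) * w x `^ (- q))%:E =
    (norm y `^ ((1 - N) * (1 / p)))%:E * (K * norm y `^ (- p^-1))%:E.
  rewrite -(integral_radial_weight y0) -ge0_integralZl//.
  - by apply: eq_integral => x _; rewrite -EFinM /kernel/=; congr EFin; ring.
  - apply/measurable_EFinP; apply: measurable_funM.
      apply: measurable_funM; first exact: measurable_fun_powR.
      by apply: measurable_funV; exact: measurable_funD.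
    by apply: measurable_fun_powR; exact: measurable_radial_weight.
  - move=> x _; rewrite lee_fin mulr_ge0 ?powR_ge0// divr_ge0 ?powR_ge0//.
    by rewrite addr_ge0 ?norm_ge0.
  - by rewrite lee_fin powR_ge0.
rewrite -EFinM lee_fin le_eqVlt; apply/orP; left; apply/eqP.
rewrite /radial_weight -expRM !gt0_powR_expR// mulrCA -expRD; congr (_ * expR _)%R.
by field; rewrite !gt_eqF.
Qed.

End conjugate.

(** The second condition of Schur's test is the first for the exchanged pair, because the weight and
    the constant are symmetric in p and q. *)
Lemma radial_schur p q (f : T -> R) : (0 < p)%R -> (0 < q)%R ->
  (p^-1 + q^-1 = 1)%R -> measurable_fun setT f -> (forall x, 0 <= f x)%R ->
  \int[mu]_y (transform mu norm N p q f y `^ p) <=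
  ((omega * (pi / sin (pi / p))) `^ p)%:E * \int[mu]_x (f x `^ p)%:E.
Proof.
move=> p0 q0 pq mf f0.
apply: (@schur _ _ _ mu p q p0 q0 pq (kernel norm N p q) (radial_weight p q)).
- exact: measurable_kernel.
- exact: kernel_ge0.
- exact: measurable_radial_weight.
- exact: radial_weight_gt0.
- exact: radial_constant_gt0 pq.
- by apply: filterS norm_gt0 => y y0; exact: radial_weight_le.
- apply: filterS norm_gt0 => x x0.
  have qp : (q^-1 + p^-1 = 1)%R by rewrite addrC.
  have := radial_weight_le q0 p0 qp x0.
  rewrite (sin_conjugate pq) radial_weightC.
  by under eq_integral do rewrite kernelC.
- by [].
- by [].
Qed.

End radial_schur.

(** * Sharpness *)

Section sharpness.
Local Open Scope ereal_scope.
Context d (T : measurableType d) (R : realType).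
Local Notation leb := (@lebesgue_measure R).
Variable mu : {sigma_finite_measure set T -> \bar R}.
Variable norm : T -> R.
Hypotheses (mnorm : measurable_fun setT norm) (norm_ge0 : forall x, (0 <= norm x)%R).
Variables (n : nat) (omega : R).
Hypothesis omega0 : (0 < omega)%R.
Hypothesis polar : forall phi : R -> \bar R,
  measurable_fun setT phi -> (forall r, 0 <= phi r) ->
  \int[mu]_x phi (norm x) =
  \int[leb]_(r in `]0%R, +oo[) (phi r * (omega * r ^+ n)%:E).
Variables p q : R.
Hypotheses (p0 : (0 < p)%R) (q0 : (0 < q)%R) (pq : (p^-1 + q^-1 = 1)%R).
Local Notation N := (n.+1%:R : R).
Local Notation H := (transform mu norm N p q).
Implicit Types (a b s r : R).

Let pn0 : (p != 0)%R. Proof. by rewrite gt_eqF. Qed.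
Let qn0 : (q != 0)%R. Proof. by rewrite gt_eqF. Qed.
Let qV : (q^-1 = 1 - p^-1)%R. Proof. by rewrite -pq addrAC subrr add0r. Qed.
Let pV01 : (0 < p^-1 < 1)%R.
Proof.
rewrite invr_gt0 p0/=; have : (0 < q^-1)%R by rewrite invr_gt0.
by rewrite qV subr_gt0.
Qed.

(** For e = -N/p the p-th power is |x|^(-N), whose integral over the shell is [omega * ln b]:
    finite, with logarithmic growth. *)
Definition power_cutoff (e b : R) (x : T) : R :=
  (norm x `^ e * \1_`[1%R, b] (norm x))%R.

Let mI a b : measurable_fun setT (\1_`[a, b] : R -> R).
Proof. exact: measurable_indic. Qed.

Let I0 a b r : (0 <= \1_`[a, b] r :> R)%R.
Proof. by rewrite indicE. Qed.

Lemma power_cutoff_ge0 e b x : (0 <= power_cutoff e b x)%R.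
Proof. by rewrite mulr_ge0 ?powR_ge0. Qed.

Lemma measurable_power_cutoff e b : measurable_fun setT (power_cutoff e b).
Proof.
apply: measurable_funM; first exact: measurable_fun_powR.
exact: (measurableT_comp (mI 1 b) mnorm).
Qed.

Lemma power_cutoff_powR e b c x : (c != 0)%R ->
  (power_cutoff e b x `^ c = power_cutoff (e * c) b x)%R.
Proof.
move=> c0; rewrite /power_cutoff powRM ?powR_ge0// -powRrM; congr (_ * _)%R.
by rewrite indicE; case: (_ \in _); rewrite ?powR1 ?powR0.
Qed.

Lemma integral_invr_itv a b : (0 < a)%R -> (a < b)%R ->
  \int[leb]_(r in `[a, b]) (r^-1)%:E = (ln b - ln a)%:E.
Proof.
move=> a0 ab; rewrite (@continuous_FTC2 _ _ (@ln R)) ?EFinB//.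
- apply: continuous_in_subspaceT => r /[!inE]/=; rewrite in_itv/= => /andP[ar _].
  by apply: cvgV; [rewrite gt_eqF// (lt_le_trans a0)|exact: cvg_id].
- split.
  + move=> r; rewrite in_itv/= => /andP[ar _].
    by have := is_derive1_ln (lt_trans a0 ar) => h; exact: ex_derive.
  + by apply: cvg_at_right_filter; exact: continuous_ln.
  + by apply: cvg_at_left_filter; apply: continuous_ln; exact: lt_trans ab.
- move=> r; rewrite in_itv/= => /andP[ar _].
  have h := is_derive1_ln (lt_trans a0 ar).
  by rewrite derive1E derive_val.
Qed.

Lemma integral_inv_cutoff a b : (0 < a)%R -> (a < b)%R ->
  \int[mu]_x (norm x `^ (- N) * \1_`[a, b] (norm x))%:E =
  (omega * (ln b - ln a))%:E.
Proof.
move=> a0 ab.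
rewrite (@polar (fun r => (r `^ (- N) * \1_`[a, b] r)%:E)); last 2 first.
- by apply/measurable_EFinP; apply: measurable_funM => //; exact: mI.
- by move=> r; rewrite lee_fin mulr_ge0 ?powR_ge0.
rewrite EFinM -integral_invr_itv// -ge0_integralZl//; last 3 first.
- apply: measurable_funTS; apply/measurable_EFinP.
  by apply: (@measurable_funV _ R R setT id).
- by move=> r /=; rewrite in_itv/= lee_fin invr_ge0 => /andP[/(le_trans (ltW a0))].
- by rewrite lee_fin ltW.
rewrite [LHS]integral_mkcond [RHS]integral_mkcond; apply: eq_integral => r _.
rewrite !patchE indicE.
have [rab|rab] := boolP (r \in `[a, b]%classic); last first.
  by rewrite mulr0 mul0e if_same.
have r0 : (0 < r)%R.
  by move: rab; rewrite inE/= in_itv/= => /andP[/(lt_le_trans a0)].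
rewrite mem_set/= ?in_itv/= ?r0// mulr1 -!EFinM; congr EFin.
rewrite mulrCA; congr (_ * _)%R.
rewrite -powR_mulrn ?(ltW r0)// -powRD; last by rewrite (gt_eqF r0) implybT.
have -> : (- N + n%:R = -1 :> R)%R by rewrite -natr1; ring.
by rewrite powR_inv1// ltW.
Qed.

(** The part of the integral for pi / sin (pi/p) that survives the cutoff when |y| stays a factor m
    away from both ends of the shell. *)
Definition truncated_kernel_integral (m : R) : \bar R :=
  \int[leb]_(t in `[(m^-1)%R, m]) (t `^ (- p^-1) / (t + 1))%:E.
Local Notation J := truncated_kernel_integral.

Let mker s : measurable_fun setT (fun r : R => (r `^ (- p^-1) / (`|r| + s))%R).
Proof.
apply: measurable_funM; first exact: measurable_fun_powR.
by apply: measurable_funV; exact: measurable_funD.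
Qed.

Let ker0 s r : (0 <= s)%R -> (0 <= r `^ (- p^-1) / (`|r| + s))%R.
Proof. by move=> s0; rewrite divr_ge0 ?powR_ge0// addr_ge0. Qed.

(** Substitute r = s t and keep only 1/m <= t <= m: for m <= s <= b/m the product s t stays in
    [1, b], where the cutoff equals 1. *)
Lemma truncated_kernel_integral_le (m b s : R) : (1 < m)%R ->
  (m <= s <= b / m)%R ->
  (s `^ (- p^-1))%:E * J m <=
  \int[leb]_(r in `]0%R, +oo[) (r `^ (- p^-1) / (`|r| + s) * \1_`[1%R, b] r)%:E.
Proof.
move=> m1 /andP[ms sb].
have m0 : (0 < m)%R by exact: lt_trans m1.
have s0 : (0 < s)%R by exact: lt_le_trans ms.
have mphi : measurable_fun setT
    (fun r : R => (r `^ (- p^-1) / (`|r| + s) * \1_`[1%R, b] r)%:E).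
  by apply/measurable_EFinP; apply: measurable_funM; [exact: mker|exact: mI].
have phi0 r : 0 <= (r `^ (- p^-1) / (`|r| + s) * \1_`[1%R, b] r)%:E.
  by rewrite lee_fin mulr_ge0// ker0// ltW.
rewrite -(ge0_integral_scale s0 mphi phi0).
rewrite -[leRHS]ge0_integralZl//; last 2 first.
- by apply: measurable_funTS; exact: (measurableT_comp mphi).
- by rewrite lee_fin ltW.
rewrite -[leLHS]ge0_integralZl//; last 3 first.
- by apply: measurable_funTS; apply/measurable_EFinP; exact: measurable_powR_kernel.
- move=> t /=; rewrite in_itv/= => /andP[mt _].
  have t0 : (0 < t)%R by apply: lt_le_trans mt; rewrite invr_gt0.
  by rewrite lee_fin divr_ge0 ?powR_ge0// addr_ge0// ltW.
- by rewrite lee_fin powR_ge0.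
apply: (@le_trans _ _ (\int[leb]_(t in `[(m^-1)%R, m]) (s%:E *
    ((s * t) `^ (- p^-1) / (`|s * t| + s) * \1_`[1%R, b] (s * t)%R)%:E)));
    last first.
  apply: ge0_subset_integral => //.
  - apply: emeasurable_funM => //; apply: measurable_funTS.
    exact: (measurableT_comp mphi).
  - by move=> t _; rewrite mule_ge0// lee_fin ltW.
  - move=> t /=; rewrite !in_itv/= andbT => /andP[mt _].
    by apply: lt_le_trans mt; rewrite invr_gt0.
rewrite le_eqVlt; apply/orP; left; apply/eqP; apply: eq_integral => t.
rewrite inE/= in_itv/= => /andP[mt tm].
have t0 : (0 < t)%R by apply: lt_le_trans mt; rewrite invr_gt0.
rewrite indicE mem_set/=; last first.
  rewrite in_itv/=; apply/andP; split.
    by rewrite -(mulfV (lt0r_neq0 m0)) ler_pM// ?invr_ge0 ltW.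
  rewrite (@le_trans _ _ (s * m)%R)//; first by rewrite ler_pM2l.
  by rewrite -ler_pdivlMr.
rewrite -!EFinM mulr1 gtr0_norm ?mulr_gt0// powRM ?(ltW s0) ?(ltW t0)//.
congr EFin; field.
by rewrite !gt_eqF// ?addr_gt0 ?mulr_gt0.
Qed.

(** On the inner shell the transform of the cutoff power is at least a multiple of the same power
    |y|^(-N/p), with a factor close to the optimal constant for large m. *)
Lemma transform_power_cutoff_ge (m b : R) (y : T) : (1 < m)%R ->
  (m <= norm y <= b / m)%R ->
  (omega * norm y `^ (- (N / p)))%:E * J m <=
  H (power_cutoff (- (N / p)) b) y.
Proof.
move=> m1 mb; have := truncated_kernel_integral_le m1 mb.
have s0 : (0 < norm y)%R.
  by case/andP: mb => my _; rewrite (lt_le_trans _ my)// (lt_trans _ m1).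
set s := norm y in s0 mb *.
pose phi (r : R) : \bar R := (r `^ (- (N / p)) * \1_`[1%R, b] r *
  (r `^ ((1 - N) * (1 / q)) / (`|r| + s) * s `^ ((1 - N) * (1 / p))))%:E.
have -> : H (power_cutoff (- (N / p)) b) y = \int[mu]_x phi (norm x).
  by apply: eq_integral => x _; rewrite /phi ger0_norm.
rewrite polar; last 2 first.
- apply/measurable_EFinP; apply: measurable_funM.
    by apply: measurable_funM => //; exact: mI.
  apply: measurable_funM => //; apply: measurable_funM => //.
  by apply: measurable_funV; exact: measurable_funD.
- move=> r; rewrite lee_fin !mulr_ge0 ?powR_ge0// invr_ge0.
  by rewrite addr_ge0// ltW.
have mphi : measurable_fun setT
    (fun r : R => (r `^ (- p^-1) / (`|r| + s) * \1_`[1%R, b] r)%:E).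
  by apply/measurable_EFinP; apply: measurable_funM; [exact: mker|exact: mI].
have -> : \int[leb]_(r in `]0%R, +oo[) (phi r * (omega * r ^+ n)%:E) =
    (omega * s `^ ((1 - N) * (1 / p)))%:E * \int[leb]_(r in `]0%R, +oo[)
      (r `^ (- p^-1) / (`|r| + s) * \1_`[1%R, b] r)%:E.
  rewrite -ge0_integralZl//.
  - apply: eq_integral => r /[!inE]/=; rewrite in_itv/= andbT => r0.
    rewrite -!EFinM; congr EFin.
    have -> : (r `^ (- p^-1) = r `^ (- (N / p)) * r `^ ((1 - N) * (1 / q)) * r ^+ n)%R.
      rewrite -powR_mulrn ?(ltW r0)// -!powRD ?(gt_eqF r0) ?implybT//.
      congr (_ `^ _)%R.
      have -> : (1 / q = 1 - p^-1)%R by rewrite div1r.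
      have -> : (N = n%:R + 1)%R by rewrite -natr1.
      by field.
    by ring.
  - exact: measurable_funTS.
  - move=> r _; rewrite lee_fin mulr_ge0// divr_ge0 ?powR_ge0//.
    by rewrite addr_ge0// ltW.
  - by rewrite lee_fin mulr_ge0 ?powR_ge0// ltW.
have -> : (omega * s `^ (- (N / p)) =
    omega * s `^ ((1 - N) * (1 / p)) * s `^ (- p^-1))%R.
  rewrite -mulrA -powRD ?(gt_eqF s0) ?implybT//; congr (_ * _ `^ _)%R.
  by field.
move=> h; rewrite EFinM -muleA lee_wpmul2l// lee_fin.
by rewrite mulr_ge0 ?powR_ge0// ltW.
Qed.

Lemma truncated_kernel_integral_ge0 (m : R) : (1 < m)%R -> 0 <= J m.
Proof.
move=> m1; apply: integral_ge0 => t /=; rewrite in_itv/= => /andP[mt _].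
have t0 : (0 < t)%R by apply: lt_le_trans mt; rewrite invr_gt0 (lt_trans _ m1).
by rewrite lee_fin divr_ge0 ?powR_ge0// addr_ge0// ltW.
Qed.

Lemma truncated_kernel_integral_fin_num (m : R) : (1 < m)%R ->
  J m \is a fin_num.
Proof.
move=> m1; rewrite ge0_fin_numE ?truncated_kernel_integral_ge0//.
apply: (@le_lt_trans _ _ (\int[leb]_(t in `]0%R, +oo[)
    (t `^ (- p^-1) / (t + 1))%:E)).
  apply: ge0_subset_integral => //.
  - by apply: measurable_funTS; apply/measurable_EFinP; exact: measurable_powR_kernel.
  - move=> t /=; rewrite in_itv/= andbT => t0.
    by rewrite lee_fin divr_ge0 ?powR_ge0// addr_ge0// ltW.
  - move=> t /=; rewrite !in_itv/= andbT => /andP[mt _].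
    by apply: lt_le_trans mt; rewrite invr_gt0 (lt_trans _ m1).
by rewrite integral_powR_kernel// ltry.
Qed.

Lemma integral_power_cutoff (e c b : R) : (c != 0)%R -> (e * c = - N)%R ->
  (1 < b)%R ->
  \int[mu]_x (power_cutoff e b x `^ c)%:E = (omega * ln b)%:E.
Proof.
move=> c0 ec b1.
have -> : (omega * ln b = omega * (ln b - ln 1))%R by rewrite ln1 subr0.
rewrite -(@integral_inv_cutoff 1 b)//; apply: eq_integral => x _.
by rewrite power_cutoff_powR// ec.
Qed.

(** With b = m^k the right side of the bound is C omega k ln m. The left side is at least omega J
    times the integral of |y|^(-N) over m <= |y| <= b/m, that is omega (k - 2) ln m: one ln m is
    lost at each end. Divide by omega ln m. *)
Lemma bilinear_bound_power_cutoff (C m : R) (k : nat) : (1 < m)%R -> (2 < k)%N ->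
  bilinear_bound mu norm N p q C (power_cutoff (- (N / p)) (m ^+ k))
    (power_cutoff (- (N / q)) (m ^+ k)) ->
  (omega * fine (J m) * (k%:R - 2) <= C * k%:R)%R.
Proof.
move=> m1 k2.
have m0 : (0 < m)%R by exact: lt_trans m1.
have L0 : (0 < ln m)%R by exact: ln_gt0.
set b := (m ^+ k)%R.
have k0 : (0 < k)%N by exact: ltn_trans k2.
have b1 : (1 < b)%R by rewrite exprn_egt1// -lt0n.
have lnb : ln b = (k%:R * ln m)%R by rewrite lnXn// mulr_natl.
set f := power_cutoff _ _; set g := power_cutoff (- (N / q)) _.
have mf : measurable_fun setT f by exact: measurable_power_cutoff.
have mg : measurable_fun setT g by exact: measurable_power_cutoff.
have f0 x : (0 <= f x)%R by exact: power_cutoff_ge0.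
have g0 x : (0 <= g x)%R by exact: power_cutoff_ge0.
move=> /(bilinear_boundE mu mnorm norm_ge0 N p q C mf f0 g0).
have Ef : \int[mu]_x (f x `^ p)%:E = (omega * ln b)%:E.
  by apply: integral_power_cutoff => //; rewrite mulNr divfK.
have Eg : \int[mu]_x (g x `^ q)%:E = (omega * ln b)%:E.
  by apply: integral_power_cutoff => //; rewrite mulNr divfK.
rewrite [X in _ <= _ * X `^ _ * _ -> _]Ef [X in _ <= _ * X `^ _ -> _]Eg.
have ob0 : (0 < omega * ln b)%R by rewrite mulr_gt0// ln_gt0.
rewrite !poweR_EFin -!EFinM -mulrA -powRD ?(gt_eqF ob0) ?implybT// pq.
rewrite powRr1 ?(ltW ob0)//.
have Jfin := truncated_kernel_integral_fin_num m1.
have mbm : (m < b / m)%R.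
  by rewrite ltr_pdivlMr// -expr2 ltr_eXn2l.
move=> hle.
have : (omega * fine (J m))%:E * \int[mu]_y
    (norm y `^ (- N) * \1_`[m, (b / m)%R] (norm y))%:E <=
    \int[mu]_y (H f y * (g y)%:E).
  rewrite -ge0_integralZl//; last 3 first.
  - apply/measurable_EFinP; apply: measurable_funM; first exact: measurable_fun_powR.
    exact: (measurableT_comp (mI m (b / m)) mnorm).
  - by move=> y _; rewrite lee_fin mulr_ge0 ?powR_ge0.
  - by rewrite lee_fin mulr_ge0 ?fine_ge0 ?truncated_kernel_integral_ge0// ltW.
  apply: ge0_le_integral => //.
  - move=> y _; rewrite mule_ge0// lee_fin mulr_ge0 ?powR_ge0//.
      by rewrite ltW.
    by rewrite fine_ge0 ?truncated_kernel_integral_ge0.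
  - apply: emeasurable_funM => //.
    apply/measurable_EFinP; apply: measurable_funM; first exact: measurable_fun_powR.
    exact: (measurableT_comp (mI m (b / m)) mnorm).
  - apply: emeasurable_funM; last exact/measurable_EFinP.
    exact: measurable_transform.
  move=> y _.
  rewrite indicE; have [yI|_] := boolP (norm y \in _); last first.
    by rewrite mulr0 mule0 mule_ge0 ?lee_fin// transform_ge0.
  have {}yI : (m <= norm y <= b / m)%R by move: yI; rewrite inE/= in_itv.
  have := transform_power_cutoff_ge m1 yI; rewrite -/f => hf.
  have s0 : (0 < norm y)%R.
    by case/andP: yI => my _; rewrite (lt_le_trans _ my).
  have gy : (g y = norm y `^ (- (N / q)))%R.
    rewrite /g /power_cutoff indicE mem_set ?mulr1//=.
    case/andP: yI => my yb; rewrite in_itv/=; apply/andP; split.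
      by rewrite (le_trans _ my)// ltW.
    by rewrite (le_trans yb)// ler_pdivrMr// ler_peMr ?ltW// (lt_trans _ b1).
  have gy0 : 0 <= (g y)%:E by rewrite lee_fin.
  apply: le_trans (lee_wpmul2r gy0 hf).
  rewrite -[X in _ <= _ * X * _]fineK// -!EFinM lee_fin mulr1 gy.
  have -> : (norm y `^ (- N) = norm y `^ (- (N / p)) * norm y `^ (- (N / q)))%R.
    rewrite -powRD ?(gt_eqF s0) ?implybT//; congr (_ `^ _)%R.
    by rewrite -opprD -mulrDr pq mulr1.
  by rewrite le_eqVlt; apply/orP; left; apply/eqP; ring.
move=> /le_trans/(_ hle).
rewrite integral_inv_cutoff// ln_div ?posrE ?(lt_trans _ b1)// lnb.
rewrite -EFinM lee_fin.
have -> : (omega * fine (J m) * (omega * (k%:R * ln m - ln m - ln m)) =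
  (omega * ln m) * (omega * fine (J m) * (k%:R - 2)))%R by ring.
have -> : (C * (omega * (k%:R * ln m)) = (omega * ln m) * (C * k%:R))%R by ring.
by rewrite ler_pM2l// mulr_gt0.
Qed.

Lemma truncated_kernel_integral_limit (B : R) :
  (forall m : R, (1 < m)%R -> J m <= B%:E) -> (pi / sin (pi * p^-1) <= B)%R.
Proof.
move=> JB; rewrite -lee_fin.
have -> : (pi / sin (pi * p^-1))%:E =
    \int[leb]_(t in `]0%R, +oo[) (t `^ (- p^-1) / (t + 1))%:E.
  by rewrite integral_powR_kernel// powR1 mul1r.
(* Increasing intervals [1/m, m] that exhaust the half-line; starting at m = 2 keeps m > 1. A point
   t is captured once m >= t + 1/t. *)
pose F (i : nat) : set R := `[(i.+2%:R^-1 : R)%R, (i.+2%:R : R)%R]%classic.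
have F0 i t : F i t -> (0 < t)%R.
  rewrite /F/= in_itv/= => /andP[it _].
  by apply: lt_le_trans it; rewrite invr_gt0.
have -> : `]0%R, +oo[%classic = \bigcup_i F i.
  apply/seteqP; split => t /=; last first.
    by move=> [i _] /F0 t0; rewrite in_itv/= andbT.
  rewrite in_itv/= andbT => t0.
  exists (Num.truncn (t + t^-1)) => //.
  have tV0 : (0 < t^-1)%R by rewrite invr_gt0.
  have h : (t + t^-1 <= (Num.truncn (t + t^-1)).+2%:R)%R.
    by apply: (le_trans (ltW (truncnS_gt _))); rewrite ler_nat.
  rewrite /F/= in_itv/=; apply/andP; split; last first.
    by apply: le_trans h; rewrite lerDl ltW.
  rewrite -[leRHS]invrK lef_pV2 ?posrE//.
  by apply: le_trans h; rewrite lerDr ltW.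
pose h t := (t `^ (- p^-1) / (t + 1))%:E.
have ndF : nondecreasing_seq F.
  move=> i j ij; apply/subsetPset => t; rewrite /F/= !in_itv/= => /andP[it ti].
  apply/andP; split; last by apply: (le_trans ti); rewrite ler_nat.
  by apply: le_trans it; rewrite lef_pV2 ?posrE// ler_nat.
have mF i : measurable (F i) by exact: measurable_itv.
have mh i : measurable_fun (F i) h.
  by apply: measurable_funTS; apply/measurable_EFinP; exact: measurable_powR_kernel.
have h0 i t : F i t -> 0 <= h t.
  by move=> /F0 t0; rewrite lee_fin divr_ge0 ?powR_ge0// addr_ge0// ltW.
have cvF := @ge0_nondecreasing_set_cvg_integral _ (measurableTypeR R) R F h leb ndF mF mh h0.
rewrite -[leLHS](cvg_lim _ cvF)//; apply: lime_le; first exact: cvgP cvF.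
by apply: nearW => i; apply: JB; rewrite ltr1n.
Qed.

Lemma bilinear_bound_sharp (C : R) :
  (forall f g : T -> R, measurable_fun setT f -> measurable_fun setT g ->
    (forall x, 0 <= f x)%R -> (forall x, 0 <= g x)%R ->
    \int[mu]_x (f x `^ p)%:E < +oo -> \int[mu]_x (g x `^ q)%:E < +oo ->
    bilinear_bound mu norm N p q C f g) ->
  (omega * (pi / sin (pi / p)) <= C)%R.
Proof.
have contradiction (a c x : R) :
    (2 * a < x * (a - c) -> a * (x - 2) <= c * x -> False)%R.
  by move=> *; lra.
move=> hC.
rewrite -ler_pdivlMl//; apply: truncated_kernel_integral_limit => m m1.
rewrite -[J m]fineK ?truncated_kernel_integral_fin_num// lee_fin ler_pdivlMl//.
set a := (omega * _)%R; rewrite leNgt; apply/negP => Ca.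
have aC0 : (0 < a - C)%R by rewrite subr_gt0.
(* If a > C, then a (k - 2) <= C k fails as soon as k (a - C) > 2 a; the offset 3 also ensures k >
   2. *)
pose k := (Num.truncn (2 * a / (a - C))).+3.
have kgt : (2 * a / (a - C) < k%:R)%R.
  apply: (lt_le_trans (truncnS_gt _)).
  by rewrite ler_nat; exact: leq_trans (leqnSn _) (leqnSn _).
have k2 : (2 < k)%N by [].
have k0 : (0 < k)%N by [].
have b1 : (1 < m ^+ k)%R by rewrite exprn_egt1.
have : (a * (k%:R - 2) <= C * k%:R)%R.
  apply: bilinear_bound_power_cutoff => //; apply: hC.
  - exact: measurable_power_cutoff.
  - exact: measurable_power_cutoff.
  - exact: power_cutoff_ge0.
  - exact: power_cutoff_ge0.
  - by rewrite integral_power_cutoff ?ltry// mulNr divfK.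
  - by rewrite integral_power_cutoff ?ltry// mulNr divfK.
by rewrite ltr_pdivrMr// in kgt; exact: contradiction kgt.
Qed.

End sharpness.

(** * The three inequalities, their equivalence and sharpness for a radial kernel *)

Section radial_hilbert.
Local Open Scope ereal_scope.
Context d (T : measurableType d) (R : realType).
Local Notation leb := (@lebesgue_measure R).
Variable mu : {sigma_finite_measure set T -> \bar R}.
Variable norm : T -> R.
Hypotheses (mnorm : measurable_fun setT norm) (norm_ge0 : forall x, (0 <= norm x)%R).
Hypothesis norm_gt0 : {ae mu, forall x, (0 < norm x)%R}.
Variables (n : nat) (omega : R).
Hypothesis omega0 : (0 < omega)%R.
Hypothesis polar : forall phi : R -> \bar R,
  measurable_fun setT phi -> (forall r, 0 <= phi r) ->
  \int[mu]_x phi (norm x) =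
  \int[leb]_(r in `]0%R, +oo[) (phi r * (omega * r ^+ n)%:E).
Local Notation N := (n.+1%:R : R).
Implicit Types (C : R) (f g : T -> R).

(** Stated separately from [operator_bound] to match [hilbert_c] literally, with the order of |x| +
    |y| unchanged. *)
Definition transposed_operator_bound p q C g : Prop :=
  (\int[mu]_x
     ((\int[mu]_y (g y / (norm x + norm y) * norm y `^ ((1 - N) * (1 / p)))%:E) `^ q
        * (norm x `^ (1 - N))%:E)) `^ (1 / q)
  <= C%:E * (\int[mu]_y (g y `^ q)%:E) `^ (1 / q).

Lemma transposed_operator_boundE p q C g :
  transposed_operator_bound p q C g <-> operator_bound mu norm N q p C g.
Proof.
have le_poweR_congr (a b c : \bar R) (s : R) : a = b -> a `^ s <= c <-> b `^ s <= c.
  by move=> ->.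
apply: le_poweR_congr.
apply: eq_integral => y _; congr (_ `^ _ * _).
by apply: eq_integral => x _; rewrite [(norm y + _)%R]addrC.
Qed.

Definition nonneg_Lfun p f := (forall x, 0 <= f x)%R /\ f \in Lfun mu p%:E.

Variables p q : R.
Hypotheses (p0 : (0 < p)%R) (q0 : (0 < q)%R) (pq : (p^-1 + q^-1 = 1)%R).
Let K : R := omega * (pi / sin (pi / p)).
Let qp : (q^-1 + p^-1 = 1)%R. Proof. by rewrite addrC. Qed.

Local Notation hilbert_a := (bilinear_bound mu norm N p q).
Local Notation hilbert_b := (operator_bound mu norm N p q).
Local Notation hilbert_c := (transposed_operator_bound p q).

Let nonneg_LfunP r f : (0 < r)%R -> nonneg_Lfun r f ->
  [/\ measurable_fun setT f, forall x, (0 <= f x)%R &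
      \int[mu]_x (f x `^ r)%:E < +oo].
Proof. by move=> r0 [f0 /(ge0_LfunP mu r0 f0)[mf fr]]. Qed.

Let LfunP r f : (0 < r)%R -> measurable_fun setT f -> (forall x, (0 <= f x)%R) ->
  \int[mu]_x (f x `^ r)%:E < +oo -> nonneg_Lfun r f.
Proof. by move=> r0 mf f0 fr; split => //; apply/(ge0_LfunP mu r0 f0). Qed.

Let K0 : (0 < K)%R.
Proof. by apply: radial_constant_gt0 pq. Qed.

Let schurp f (mf : measurable_fun setT f) (f0 : forall x, (0 <= f x)%R) :
  \int[mu]_y (transform mu norm N p q f y `^ p) <=
  (K `^ p)%:E * \int[mu]_x (f x `^ p)%:E :=
  radial_schur mnorm norm_ge0 norm_gt0 omega0 polar p0 q0 pq mf f0.

Let schurq f (mf : measurable_fun setT f) (f0 : forall x, (0 <= f x)%R) :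
  \int[mu]_y (transform mu norm N q p f y `^ q) <=
  (K `^ q)%:E * \int[mu]_x (f x `^ q)%:E.
Proof.
have := radial_schur mnorm norm_ge0 norm_gt0 omega0 polar q0 p0 qp mf f0.
by rewrite (sin_conjugate pq).
Qed.

Lemma bilinear_operatorP C f : nonneg_Lfun p f ->
  (forall g, nonneg_Lfun q g -> hilbert_a C f g) <-> hilbert_b C f.
Proof.
move=> /(nonneg_LfunP p0)[mf f0 fp]; split => [ha|hb g /(nonneg_LfunP q0)[mg g0 gq]].
  apply: (bilinear_operator_bound mnorm norm_ge0 p0 q0 pq schurp mf f0 fp) => g mg g0 gq.
  by apply: ha; exact: LfunP.
exact: (operator_bilinear_bound mnorm norm_ge0 p0 q0 pq schurp mf f0 fp mg g0 hb).
Qed.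

Lemma bilinear_transposed_operatorP C g : nonneg_Lfun q g ->
  (forall f, nonneg_Lfun p f -> hilbert_a C f g) <-> hilbert_c C g.
Proof.
move=> /(nonneg_LfunP q0)[mg g0 gq]; split => [ha|/transposed_operator_boundE hc f /(nonneg_LfunP p0)[mf f0 fp]].
  apply/transposed_operator_boundE.
  apply: (bilinear_operator_bound mnorm norm_ge0 q0 p0 qp schurq mg g0 gq) => f mf f0 fp.
  by apply/bilinear_boundC => //; apply: ha; exact: LfunP.
apply/bilinear_boundC => //.
exact: (operator_bilinear_bound mnorm norm_ge0 q0 p0 qp schurq mg g0 gq mf f0 hc).
Qed.

(** (b) and (c) come from Schur's test and (a) from (b). Since the equivalences hold for every C, a
    smaller constant in (b) or (c) would give one in (a), so sharpness is tested on (a) only. *)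
Lemma radial_hilbert :
  [/\ forall f g, nonneg_Lfun p f -> nonneg_Lfun q g -> hilbert_a K f g,
      forall f, nonneg_Lfun p f -> hilbert_b K f
    & forall g, nonneg_Lfun q g -> hilbert_c K g]
  /\
  (forall C,
    (forall f, nonneg_Lfun p f ->
       ((forall g, nonneg_Lfun q g -> hilbert_a C f g) <-> hilbert_b C f)) /\
    (forall g, nonneg_Lfun q g ->
       ((forall f, nonneg_Lfun p f -> hilbert_a C f g) <-> hilbert_c C g)))
  /\
  (forall C, (C < K)%R ->
    [/\ ~ (forall f g, nonneg_Lfun p f -> nonneg_Lfun q g -> hilbert_a C f g),
        ~ (forall f, nonneg_Lfun p f -> hilbert_b C f)
      & ~ (forall g, nonneg_Lfun q g -> hilbert_c C g)]).
Proof.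
have hb f : nonneg_Lfun p f -> hilbert_b K f.
  move=> /(nonneg_LfunP p0)[mf f0 _].
  exact: (operator_bound_constant mnorm norm_ge0 p0 K0 schurp).
have hc g : nonneg_Lfun q g -> hilbert_c K g.
  move=> /(nonneg_LfunP q0)[mg g0 _]; apply/transposed_operator_boundE.
  exact: (operator_bound_constant mnorm norm_ge0 q0 K0 schurq).
have sharp C : (C < K)%R ->
    ~ (forall f g, nonneg_Lfun p f -> nonneg_Lfun q g -> hilbert_a C f g).
  rewrite ltNge => /negP CK ha; apply: CK.
  apply: (bilinear_bound_sharp mnorm norm_ge0 omega0 polar p0 q0 pq).
  by move=> f g mf mg f0 g0 fp gq; apply: ha; exact: LfunP.
split; first split => //.
  by move=> f g fp gq; apply: (bilinear_operatorP K fp).2 gq; exact: hb.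
split=> [C|C CK]; first split.
- by move=> f; exact: bilinear_operatorP.
- by move=> g; exact: bilinear_transposed_operatorP.
split; first exact: sharp.
- move=> hbC; apply: (sharp C CK) => f g fp gq.
  by apply: (bilinear_operatorP C fp).2 gq; exact: hbC.
- move=> hcC; apply: (sharp C CK) => f g fp gq.
  by apply: (bilinear_transposed_operatorP C gq).2 fp; exact: hcC.
Qed.

End radial_hilbert.

Lemma hilbert_constantE (R : realType) (n : nat) (p : R) : hilbert_constant n p =
  unit_ball_volume R n * n%:R * (pi / sin (pi / p)).
Proof. by rewrite /hilbert_constant /unit_ball_volume; ring. Qed.

Theorem corollary3p2 (R : realType) (n : nat) (p q : R) :
  (0 < n)%N -> 1 < p -> q = p / (p - 1) ->
  let K := hilbert_constant n p in
  [/\ forall f g : euclidean_space R n -> R,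
        nonneg_Lp p f -> nonneg_Lp q g -> hilbert_a p q K f g,
      forall f : euclidean_space R n -> R, nonneg_Lp p f -> hilbert_b p q K f
    & forall g : euclidean_space R n -> R, nonneg_Lp q g -> hilbert_c p q K g]
  /\
  (forall C : R,
    (forall f : euclidean_space R n -> R, nonneg_Lp p f ->
       ((forall g : euclidean_space R n -> R,
           nonneg_Lp q g -> hilbert_a p q C f g) <-> hilbert_b p q C f)) /\
    (forall g : euclidean_space R n -> R, nonneg_Lp q g ->
       ((forall f : euclidean_space R n -> R,
           nonneg_Lp p f -> hilbert_a p q C f g) <-> hilbert_c p q C g)))
  /\
  (forall C : R, C < K ->
    [/\ ~ (forall f g : euclidean_space R n -> R,
             nonneg_Lp p f -> nonneg_Lp q g -> hilbert_a p q C f g),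
        ~ (forall f : euclidean_space R n -> R,
             nonneg_Lp p f -> hilbert_b p q C f)
      & ~ (forall g : euclidean_space R n -> R,
             nonneg_Lp q g -> hilbert_c p q C g)]).
Proof.
move=> n0 p1 qE K; rewrite {}/K hilbert_constantE.
have p0 : 0 < p by exact: lt_trans p1.
have p10 : 0 < p - 1 by rewrite subr_gt0.
have q0 : 0 < q by rewrite qE divr_gt0.
have pq : p^-1 + q^-1 = 1 by rewrite qE invf_div; field; rewrite gt_eqF.
(* With the dimension written as a successor, its predecessor is the exponent of the Jacobian. *)
case: n n0 => // n _.
have omega0 : 0 < unit_ball_volume R n.+1 * n.+1%:R.
  by rewrite mulr_gt0 ?unit_ball_volume_gt0.
exact: (radial_hilbert (@measurable_euclidean_norm R n.+1)
  (@euclidean_norm_ge0 R n.+1) (@euclidean_norm_gt0_ae R n)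
  omega0 (@integral_polar R n) p0 q0 pq).
Qed.
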